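(* Let $0<\alpha<1$ and $p>1$. Let $L,R$ be non-negative random variables such that $\mathbb{P}\{L>0\}+\mathbb{P}\{R>0\}>1$, $\mathbb{E}[L^\alpha+R^\alpha]=1$ and $\mathbb{E}[L^p+R^p]<1$. Let $\bar\mu_0$ be a Borel probability measure on $\mathbb{R}$ whose distribution function $F_0$ satisfies $$\lim_{x\to+\infty}x^\alpha(1-F_0(x))=c_0^+<+\infty,\qquad \lim_{x\to-\infty}|x|^\alpha F_0(x)=c_0^-<+\infty .$$ Let $(\mu_t)_{t\ge 0}$ be the solution of the kinetic equation with initial datum $\bar\mu_0$ and let $\mu_\infty$ be the corresponding steady state. Assume $d_p(\bar\mu_0,\mu_\infty)<+\infty$. Put $K_1(p)=\max\{\varphi(1),\varphi(p)\}$. Then there exists a constant $C_p=C_p(\bar\mu_0)<+\infty$ such that, for every $t\ge 0$, $$d_p(\mu_t,\mu_\infty)\le \begin{cases} C_p\, e^{-t|K_1(p)|} & \text{if } \varphi(p)\neq\varphi(1),\\ C_p\,t\, e^{-t|K_1(p)|} & \text{if } \varphi(p)=\varphi(1).\end{cases}$$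
   Context: Notation: $\mathcal{S}(s)=\mathbb{E}[L^s+R^s]-1$ and $\varphi(q)=\mathcal{S}(q)/q$ for $q>0$. Solution: given a Borel probability measure $\bar\mu_0$ on $\mathbb{R}$, the solution of the kinetic equation with initial datum $\bar\mu_0$ is the unique family $(\mu_t)_{t\ge0}$ of probability measures on $\mathbb{R}$ whose Fourier–Stieltjes transforms $\hat\mu_t(\xi)=\int e^{i\xi v}\mu_t(dv)$ satisfy $\partial_t\hat\mu_t(\xi)+\hat\mu_t(\xi)=\mathbb{E}[\hat\mu_t(L\xi)\hat\mu_t(R\xi)]$ for $t>0$, $\xi\in\mathbb{R}$, with $\hat\mu_0(\xi)=\int e^{i\xi v}\bar\mu_0(dv)$. Equivalently $\mu_t=\sum_{n\ge0}e^{-t}(1-e^{-t})^n\rho_n$, where $\rho_0=\bar\mu_0$ and, for $n\ge1$, $\rho_n=\frac1n\sum_{j=0}^{n-1}Q^+(\rho_j,\rho_{n-1-j})$, $Q^+(\mu,\nu)$ being the law of $LX+RY$ with $X\sim\mu$, $Y\sim\nu$ and $X,Y,(L,R)$ independent. Mixing measure: $\nu_\alpha$ is the unique probability measure on $[0,+\infty)$ with $\int v\,\nu_\alpha(dv)=1$ whose Fourier–Stieltjes transform satisfies $\hat\nu_\alpha(\xi)=\mathbb{E}[\hat\nu_\alpha(L^\alpha\xi)\hat\nu_\alpha(R^\alpha\xi)]$ for all $\xi\in\mathbb{R}$. Steady state: $\mu_\infty$ is the probability measure on $\mathbb{R}$ (the weak limit of $\mu_t$ as $t\to+\infty$) with $$\int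 e^{i\xi v}\mu_\infty(dv)=\int_{[0,+\infty)}e^{-\lambda m|\xi|^\alpha[1-i\beta\tan(\pi\alpha/2)\operatorname{sign}\xi]}\nu_\alpha(dm),$$ where $\lambda=\frac{(c_0^++c_0^-)\pi}{2\Gamma(\alpha)\sin(\pi\alpha/2)}$ and $\beta=\frac{c_0^+-c_0^-}{c_0^++c_0^-}$ (with $\beta=0$ if $c_0^++c_0^-=0$). Wasserstein distance of order $p>0$: $d_p(\mu_1,\mu_2)=\inf_m\big(\int_{\mathbb{R}^2}|x-y|^p m(dx\,dy)\big)^{\min(1,1/p)}$, the infimum being over all couplings $m$ of $\mu_1,\mu_2$; it may be $+\infty$.
   Formalization: In the case φ(p)=φ(1) the factor t is replaced by max(1,t): as printed the bound at t=0 would force d_p(μ̄_0,μ_∞)=0, which fails e.g. for p=2, L=R=1−1/√2, μ̄_0=δ_1, μ_∞=δ_0; for t≥1 the bound is the printed one. *)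

(* Defs.v *)
From HB Require Import structures.
From mathcomp Require Import all_boot all_order all_algebra.
From mathcomp Require Import all_classical all_reals all_analysis.
From mathcomp Require Import complex.

Set Implicit Arguments.
Unset Strict Implicit.
Unset Printing Implicit Defensive.

Import Order.TTheory GRing.Theory Num.Theory.
Import numFieldNormedType.Exports.

Local Open Scope classical_set_scope.
Local Open Scope ring_scope.
Local Open Scope complex_scope.

Notation law K := (probability (measurableTypeR K) K).

(* The library has no integral, exponential or derivative for R[i]-valued
   functions; these are taken componentwise. *)
Definition cexp (K : realType) (z : K[i]) : K[i] :=
  (expR (complex.Re z))%:C *
  (cos (complex.Im z) +i* sin (complex.Im z)).

Definition cintegral (d : measure_display) (T : measurableType d)
    (K : realType) (m : {measure set T -> \bar K}) (D : set T)
    (f : T -> K[i]) : K[i] :=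
  (\int[m]_(x in D) complex.Re (f x)) +i* (\int[m]_(x in D) complex.Im (f x)).

Definition is_cderive (K : realType) (g : K -> K[i]) (t : K) (z : K[i]) : Prop :=
  is_derive t 1 (fun s : K => complex.Re (g s)) (complex.Re z) /\
  is_derive t 1 (fun s : K => complex.Im (g s)) (complex.Im z).

Definition ccontinuous_within (K : realType) (D : set K) (g : K -> K[i]) : Prop :=
  {within D, continuous (fun s : K => complex.Re (g s))} /\
  {within D, continuous (fun s : K => complex.Im (g s))}.

Definition charf (K : realType) (mu : law K) (xi : K) : K[i] :=
  cintegral mu setT (fun v => cexp ('i%C * (xi * v)%:C)).

Definition Gamma (K : realType) (a : K) : K :=
  \int[@lebesgue_measure K]_(x in `]0, +oo[) (x `^ (a - 1) * expR (- x)).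

Definition momentLR (d : measure_display) (T : measurableType d)
    (K : realType) (P : probability T K) (L R : {RV P >-> K}) (s : K) : \bar K :=
  ('E_P[fun w => (L w `^ s + R w `^ s)%R])%E.

(* [fine] sends an infinite moment to 0: these two are meaningful only when
   [momentLR P L R s] is finite. *)
Definition spectral (d : measure_display) (T : measurableType d)
    (K : realType) (P : probability T K) (L R : {RV P >-> K}) (s : K) : K :=
  fine (momentLR L R s) - 1.

Definition phi (d : measure_display) (T : measurableType d)
    (K : realType) (P : probability T K) (L R : {RV P >-> K}) (q : K) : K :=
  spectral L R q / q.

Definition K1 (d : measure_display) (T : measurableType d)
    (K : realType) (P : probability T K) (L R : {RV P >-> K}) (p : K) : K :=
  Num.max (phi L R 1) (phi L R p).

Definition distr_fun (K : realType) (mu : law K) (x : K) : K :=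
  fine (mu `]-oo, x]%classic).

Definition kinetic_solution (d : measure_display) (T : measurableType d)
    (K : realType) (P : probability T K) (L R : {RV P >-> K})
    (mu0 : law K) (mu : K -> law K) : Prop :=
  forall xi : K,
  [/\ charf (mu 0) xi = charf mu0 xi,
      (* continuity at t = 0 links the initial datum to the equation, which
         only concerns t > 0 *)
      ccontinuous_within `[0, +oo[ (fun t => charf (mu t) xi) &
      forall t : K, 0 < t ->
        exists2 dt : K[i], is_cderive (fun s => charf (mu s) xi) t dt &
          dt + charf (mu t) xi =
          cintegral P setT
            (fun w => charf (mu t) (L w * xi) * charf (mu t) (R w * xi))].

Definition mixing_measure (d : measure_display) (T : measurableType d)
    (K : realType) (P : probability T K) (L R : {RV P >-> K})
    (alpha : K) (nu : law K) : Prop :=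
  [/\ nu `[(0 : K), +oo[%classic = 1%E,
      (\int[nu]_(v in `[0%R, +oo[%classic) v%:E = 1)%E &
      forall xi : K, charf nu xi =
        cintegral P setT (fun w =>
          charf nu (L w `^ alpha * xi) * charf nu (R w `^ alpha * xi))].

Definition stable_scale (K : realType) (alpha c0p c0m : K) : K :=
  ((c0p + c0m) * pi) / (2 * Gamma alpha * sin (pi * alpha / 2)).

Definition stable_skew (K : realType) (c0p c0m : K) : K :=
  if c0p + c0m == 0 then 0 else (c0p - c0m) / (c0p + c0m).

Definition steady_state (K : realType) (alpha c0p c0m : K)
    (nu muoo : law K) : Prop :=
  forall xi : K, charf muoo xi =
    cintegral nu `[(0 : K), +oo[%classic (fun m =>
      cexp (- (stable_scale alpha c0p c0m * m * `|xi| `^ alpha)%:C *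
            (1 - 'i%C * (stable_skew c0p c0m * tan (pi * alpha / 2)
                       * Num.sg xi)%:C))).

Definition coupling (K : realType) (mu1 mu2 : law K)
    (m : probability (measurableTypeR K * measurableTypeR K)%type K) : Prop :=
  forall A : set (measurableTypeR K), measurable A ->
    m (A `*` setT) = mu1 A /\ m (setT `*` A) = mu2 A.

Definition wasserstein (K : realType) (p : K) (mu1 mu2 : law K) : \bar K :=
  ereal_inf [set poweR (\int[m]_z (`|z.1 - z.2| `^ p)%R%:E)%E (Num.min 1 p^-1)
            | m in [set m | coupling mu1 mu2 m]].

(* In the resonant case phi p = phi 1 the prefactor is max(1,t) instead of t:
   the two agree for t >= 1, whereas a bound C * t * e^(-t|K1|) at t = 0 would
   force mu0 = muoo. *)
Definition rate (d : measure_display) (T : measurableType d)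
    (K : realType) (P : probability T K) (L R : {RV P >-> K}) (p t : K) : K :=
  if phi L R p == phi L R 1
  then Num.max 1 t * expR (- (t * `|K1 L R p|))
  else expR (- (t * `|K1 L R p|)).

(* Main.v *)
Require Import Defs.
From HB Require Import structures.
From mathcomp Require Import all_boot all_order all_algebra.
From mathcomp Require Import all_classical all_reals all_analysis.
From mathcomp Require Import complex.
From mathcomp Require Import measurable_realfun ring lra.

Set Implicit Arguments.
Unset Strict Implicit.
Unset Printing Implicit Defensive.

Import Order.TTheory GRing.Theory Num.Theory.
Import numFieldNormedType.Exports.
Local Open Scope classical_set_scope.
Local Open Scope ring_scope.

(** The distance at time [t] is bounded by the cost of one explicit coupling.

    Start from a coupling [m0] of the initial datum with the steady state that
    has finite cost of order [p], and run Wild's recursion in the plane: two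
    independent pairs collide and their coordinates are combined with the same
    coefficients [(L, R)]. The Wild mixture of the laws obtained, with weights
    [e^(- t) (1 - e^(- t))^n], is a law on the plane. Its first marginal is the
    Wild sum of the initial datum, hence the law at time [t]
    ([remainder_le]). Its second marginal is the steady state, which is a fixed
    point of the smoothing transformation ([steady_state_fixed]): by the
    equation for its transform the mixing measure [nu] is the law of
    [L^alpha X + R^alpha X'], and the stable exponent is homogeneous of degree
    [alpha]. So the mixture is a coupling ([contraction_along_wild]). The
    passage from transforms to laws is the uniqueness theorem for
    characteristic functions ([charf_inj]); it is obtained by showing that the
    indicators of intervals can be reached from cosines by algebraic operations
    and bounded pointwise limits.

    For the cost, let [D] be the distance of the two coordinates. One collision
    gives at most [L D + R D'] with [D], [D'] independent. Taking means, the
    first moment along the mixture is at most a constant times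
    [e^(phi(1) t)]. For the order [p], the inequality
    [(u + v)^p <= u^p + v^p + 2^p (u^(p-1) v + u v^(p-1))] produces, besides
    the factor [E(L^p + R^p)], mixed terms that contain a first moment and a
    moment of order [p - 1], the latter at most [M^(p-1)] if [M] is the [p]-th
    root of the moment of order [p]. Thus
    [(M^p)' <= S(p) M^p + k e^(phi(1) t) M^(p-1)], and dividing by
    [p M^(p-1)] leaves the linear inequality
    [M' <= phi(p) M + (k/p) e^(phi(1) t)]. Its solutions decay as
    [e^(t max(phi(1), phi(p)))], with an additional factor [t] in the resonant
    case ([wsum_moment_growth], [wild_moment_growth]). Both exponents are
    nonpositive: for [phi(1)] because [1] lies between [alpha], where the
    moment is [1], and [p], where it is less than [1] ([momentLR1_le1]).

    With [z = 1 - e^(- t)] the Wild series is a power series in [z], and all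
    differential inequalities are applied to its partial sums. *)

(** * Bounded measurable functions *)

Definition bounded_mfun d (T : measurableType d) (K : realType) (f : T -> K) :=
  measurable_fun setT f /\ exists M, forall x, `|f x| <= M.

Section bounded_measurable.
Context d (T : measurableType d) (K : realType).
Implicit Types f g : T -> K.

Lemma bdm_integrable (m : probability T K) f :
  bounded_mfun f -> m.-integrable setT (EFin \o f).
Proof.
move=> [mf [M fM]]; apply: measurable_bounded_integrable; [by []| |by []|].
  by rewrite [X in (X < _)%E](probability_setT m) ltry.
by exists M; split; [exact: num_real|move=> x Mx y _; exact: le_trans (fM y) (ltW Mx)].
Qed.

Lemma bdm_cst (k : K) : bounded_mfun (fun _ : T => k).
Proof. by split; [exact: measurable_cst|exists `|k|]. Qed.

Lemma bdmD f g : bounded_mfun f -> bounded_mfun g -> bounded_mfun (fun x => f x + g x).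
Proof.
move=> [mf [M fM]] [mg [N gN]]; split; first exact: measurable_funD.
by exists (M + N) => x; rewrite (le_trans (ler_normD _ _))// lerD.
Qed.

Lemma bdmM f g : bounded_mfun f -> bounded_mfun g -> bounded_mfun (fun x => f x * g x).
Proof.
move=> [mf [M fM]] [mg [N gN]]; split; first exact: measurable_funM.
by exists (M * N) => x; rewrite normrM ler_pM.
Qed.

Lemma bdmZ k f : bounded_mfun f -> bounded_mfun (fun x => k * f x).
Proof. by move=> bf; apply: bdmM => //; exact: bdm_cst. Qed.

Lemma bdm_comp d' (U : measurableType d') (h : U -> T) f :
  measurable_fun setT h -> bounded_mfun f -> bounded_mfun (fun x => f (h x)).
Proof.
by move=> mh [mf [M fM]]; split; [exact: measurableT_comp|exists M].
Qed.

Lemma bdm_lim (g_ : nat -> T -> K) g M :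
  (forall n, measurable_fun setT (g_ n)) -> (forall n x, `|g_ n x| <= M) ->
  (forall x, g_ n x @[n --> \oo] --> g x) -> bounded_mfun g.
Proof.
move=> mg gM gg; split.
  apply: (measurable_fun_cvg mg) => x _; exact: gg.
exists M => x.
have : `|g_ n x| @[n --> \oo] --> `|g x| by apply: cvg_norm; exact: gg.
by move/cvgr_to_le; apply; apply: nearW => n; exact: gM.
Qed.

Lemma bdm_Rintegral_lim (m : probability T K) (g_ : nat -> T -> K) g M :
  (forall n, measurable_fun setT (g_ n)) -> (forall n x, `|g_ n x| <= M) ->
  (forall x, g_ n x @[n --> \oo] --> g x) ->
  \int[m]_x g_ n x @[n --> \oo] --> \int[m]_x g x.
Proof.
move=> mg gM gg.
have [mgl _] := bdm_lim mg gM gg.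
have [|||||ig _ cg] := @dominated_convergence _ _ _ m setT measurableT
  (fun n => EFin \o g_ n) (EFin \o g) (fun=> M%:E).
- by move=> n; exact/measurable_EFinP.
- exact/measurable_EFinP.
- by apply: aeW => x _; apply: cvg_EFin; [exact: nearW|exact: gg].
- exact: bdm_integrable (bdm_cst M).
- by apply: aeW => x n _; rewrite /= lee_fin.
apply: fine_cvg; rewrite fineK //; exact: integrable_fin_num.
Qed.

End bounded_measurable.

(** * Characteristic functions determine laws *)

Section trigonometric_multipliers.
Context (K : realType) (mu1 mu2 : law K).

(** Having the same integral against two laws is not stable under products.
    Asking it of [f] times every cosine, and then looking at the functions [g]
    whose product with any such [f] is again one, gives a class that is an
    algebra for trivial reasons and contains the cosines by the product
    formula. *)
Definition trig_agree (f : K -> K) := bounded_mfun (f : measurableTypeR K -> K) /\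
  forall a b, \int[mu1]_x (f x * cos (a * x + b)) =
              \int[mu2]_x (f x * cos (a * x + b)).

Definition trig_mult (g : K -> K) := bounded_mfun (g : measurableTypeR K -> K) /\
  forall f, trig_agree f -> trig_agree (fun x => f x * g x).

Lemma bdm_cos (a b : K) :
  bounded_mfun ((fun x => cos (a * x + b)) : measurableTypeR K -> K).
Proof.
split; last by exists 1 => x; exact: cos_max.
apply: measurableT_comp.
  by apply: continuous_measurable_fun; exact: continuous_cos.
by apply: measurable_funD => //; apply: measurable_funM.
Qed.

Lemma trig_mult_cos a b : trig_mult (fun x => cos (a * x + b)).
Proof.
split; first exact: bdm_cos.
move=> f [bf hf]; split; first exact: bdmM (bdm_cos a b).
move=> c e.
have E (m : law K) : \int[m]_x (f x * cos (a * x + b) * cos (c * x + e)) =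
    2^-1 * (\int[m]_x (f x * cos ((a + c) * x + (b + e))) +
            \int[m]_x (f x * cos ((a - c) * x + (b - e)))).
  have i1 u v := bdm_integrable m (bdmM bf (bdm_cos u v)).
  rewrite -RintegralD// -RintegralZl//; last first.
    exact: bdm_integrable (bdmD (bdmM bf (bdm_cos _ _)) (bdmM bf (bdm_cos _ _))).
  apply: eq_Rintegral => x _.
  rewrite (_ : (a + c) * x + (b + e) = (a * x + b) + (c * x + e)); last ring.
  rewrite (_ : (a - c) * x + (b - e) = (a * x + b) - (c * x + e)); last ring.
  by move: (a * x + b) (c * x + e) => A B; rewrite cosD cosB; field.
by rewrite !E !hf.
Qed.

Lemma trig_mult_cst k : trig_mult (fun=> k).
Proof.
split; first exact: (@bdm_cst _ (measurableTypeR K)).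
move=> f [bf hf]; split.
  by apply: bdmM bf _; exact: (@bdm_cst _ (measurableTypeR K)).
move=> a b.
have E (m : law K) : \int[m]_x (f x * k * cos (a * x + b)) =
    k * \int[m]_x (f x * cos (a * x + b)).
  rewrite -RintegralZl//; last exact: bdm_integrable (bdmM bf (bdm_cos a b)).
  by apply: eq_Rintegral => x _; ring.
by rewrite !E hf.
Qed.

Lemma trig_multD g h : trig_mult g -> trig_mult h ->
  trig_mult (fun x => g x + h x).
Proof.
move=> [bg hg] [bh hh]; split; first exact: bdmD.
move=> f tf; have [bfg fg] := hg f tf; have [bfh fh] := hh f tf.
split; first by apply: bdmM (bdmD bg bh); case: tf.
move=> a b.
have E (m : law K) : \int[m]_x (f x * (g x + h x) * cos (a * x + b)) =
    \int[m]_x (f x * g x * cos (a * x + b)) +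
    \int[m]_x (f x * h x * cos (a * x + b)).
  rewrite -RintegralD//; [|exact: bdm_integrable (bdmM bfg (bdm_cos a b))
    |exact: bdm_integrable (bdmM bfh (bdm_cos a b))].
  by apply: eq_Rintegral => x _; ring.
by rewrite !E fg fh.
Qed.

Lemma trig_multM g h : trig_mult g -> trig_mult h ->
  trig_mult (fun x => g x * h x).
Proof.
move=> [bg hg] [bh hh]; split; first exact: bdmM.
by move=> f /hg/hh; under eq_fun do rewrite -mulrA.
Qed.

(** Bounded convergence makes the class of multipliers stable under bounded
    pointwise limits; this is what allows passing from trigonometric
    polynomials to indicators. *)
Lemma trig_mult_lim (g_ : nat -> K -> K) g M :
  (forall n, trig_mult (g_ n)) -> (forall n x, `|g_ n x| <= M) ->
  (forall x, g_ n x @[n --> \oo] --> g x) -> trig_mult g.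
Proof.
move=> tg gM gg.
have mg n : measurable_fun setT (g_ n : measurableTypeR K -> K) := (tg n).1.1.
have bg : bounded_mfun (g : measurableTypeR K -> K) by exact: bdm_lim mg gM gg.
split=> // f tf; have [bf _] := tf; split; first exact: bdmM.
move=> a b; have [_ [F fF]] := bf.
have L (m : law K) : \int[m]_x (f x * g_ n x * cos (a * x + b)) @[n --> \oo]
    --> \int[m]_x (f x * g x * cos (a * x + b)).
  apply: (@bdm_Rintegral_lim _ _ _ m _ _ (F * M)).
  - move=> n; apply: (bdmM _ (bdm_cos a b)).1; apply: bdmM => //.
    exact: (tg n).1.
  - move=> n x; rewrite normrM -[leRHS]mulr1 ler_pM//; last exact: cos_max.
    by rewrite normrM ler_pM.
  - move=> x; apply: cvgMl; apply: cvgMr; exact: gg.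
have E : (fun n => \int[mu1]_x (f x * g_ n x * cos (a * x + b))) =
    (fun n => \int[mu2]_x (f x * g_ n x * cos (a * x + b))).
  by apply/funext => n; have [_ ] := (tg n).2 f tf; apply.
have := L mu1; rewrite E => L1; exact: (cvg_unique _ L1 (L mu2)).
Qed.

Lemma trig_multX g n : trig_mult g -> trig_mult (fun x => g x ^+ n).
Proof.
move=> tg; elim: n => [|n ih]; first exact: trig_mult_cst.
by under eq_fun do rewrite exprS; exact: trig_multM.
Qed.

(** The partial sums of the exponential series are polynomials in [g], and are
    bounded by [exp (sup |g|)]. *)
Lemma trig_mult_exp g : trig_mult g -> trig_mult (fun x => expR (g x)).
Proof.
move=> tg; have [[_ [M gM]] _] := tg.
apply: (@trig_mult_lim (fun n x => series (exp_coeff (g x)) n) _ (expR M)).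
- elim=> [|n ih].
    rewrite (_ : (fun _ => _) = fun=> 0); first exact: trig_mult_cst.
    by apply/funext => x; rewrite /series/= big_nil.
  rewrite (_ : (fun _ => _) = fun x => series (exp_coeff (g x)) n +
    g x ^+ n * (n`!%:R)^-1); last first.
    by apply/funext => x; rewrite /series/= big_nat_recr.
  by apply: trig_multD ih _; apply: trig_multM;
    [exact: trig_multX|exact: trig_mult_cst].
- move=> n x; apply: (@le_trans _ _ (series (exp_coeff M) n)).
    rewrite /series/=; apply: (le_trans (ler_norm_sum _ _ _)); apply: ler_sum => i _.
    rewrite /exp_coeff/= normrM normfV normrX [`|i`!%:R|]ger0_norm//.
    by rewrite ler_wpM2r ?invr_ge0// lerXn2r// nnegrE ?(le_trans _ (gM x)).
  apply: nondecreasing_cvgn_le; last exact: is_cvg_series_exp_coeff.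
  apply/nondecreasing_series => i _ _; apply: exp_coeff_ge0.
  by rewrite (le_trans _ (gM x)).
- move=> x; exact: is_cvg_series_exp_coeff.
Qed.

End trigonometric_multipliers.
Section trigonometric_multipliers_indicators.
Context (K : realType) (mu1 mu2 : law K).
Let mult := trig_mult mu1 mu2.

Lemma cvg_expRNn (c : K) : 0 < c -> expR (- (n%:R * c)) @[n --> \oo] --> (0 : K).
Proof.
move=> c0; under eq_fun do rewrite -mulrN expRM_natl.
apply: cvg_expr; rewrite ger0_norm ?expR_ge0//.
by rewrite expR_lt1 oppr_lt0.
Qed.

(** [exp (- n g^2)] tends to the indicator of the zeros of [g]. *)
Lemma trig_mult_eq0 g : mult g -> mult (fun x => (g x == 0)%R%:R : K).
Proof.
move=> tg; apply: (@trig_mult_lim _ _ _ (fun n x => expR (- n%:R * (g x * g x))) _ 1).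
- move=> n; apply: trig_mult_exp; apply: trig_multM; first exact: trig_mult_cst.
  exact: trig_multM.
- move=> n x; rewrite ger0_norm ?expR_ge0// expR_le1 mulNr oppr_le0.
  by rewrite mulr_ge0// -expr2 sqr_ge0.
- move=> x; under eq_fun do rewrite mulNr.
  have [->|gx] := eqVneq (g x) 0.
    by under eq_fun do rewrite !mulr0 oppr0 expR0; exact: cvg_cst.
  by apply: cvg_expRNn; rewrite -expr2 exprn_even_gt0.
Qed.

(** The double exponential [exp (- exp (n g))] tends to the indicator of
    [g < 0], up to a value at the zeros of [g] that is corrected separately. *)
Lemma trig_mult_lt0 g : mult g -> mult (fun x => (g x < 0)%R%:R : K).
Proof.
move=> tg.
have -> : (fun x => (g x < 0)%R%:R : K) = (fun x => ((g x < 0)%R%:R +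
    expR (-1) * (g x == 0)%R%:R) + - expR (-1) * (g x == 0)%R%:R) :> (K -> K).
  by apply/funext => x; ring.
apply: trig_multD; last first.
  by apply: trig_multM; [exact: trig_mult_cst|exact: trig_mult_eq0].
apply: (@trig_mult_lim _ _ _ (fun n x => expR (- 1 * expR (n%:R * g x))) _ 1).
- move=> n; apply: trig_mult_exp; apply: trig_multM; first exact: trig_mult_cst.
  by apply: trig_mult_exp; apply: trig_multM => //; exact: trig_mult_cst.
- by move=> n x; rewrite ger0_norm ?expR_ge0// expR_le1 mulN1r oppr_le0 expR_ge0.
- move=> x; under eq_fun do rewrite mulN1r.
  case: (ltgtP (g x) 0) => gx; rewrite ?mulr0 ?addr0 ?add0r ?mulr1; last first.
  + rewrite gx; under eq_fun do rewrite mulr0 expR0; exact: cvg_cst.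
  + apply: (@squeeze_cvgr _ _ _ _ (fun=> 0) (fun n => expR (- (n%:R * g x)))).
    * apply: nearW => n; rewrite expR_ge0/= !expRN.
      rewrite lef_pV2 ?posrE ?expR_gt0//.
      by rewrite (le_trans _ (expR_ge1Dx _))// lerDr.
    * exact: cvg_cst.
    * exact: cvg_expRNn.
  + have -> : true%:R = expR (- 0) :> K by rewrite oppr0 expR0.
    apply: continuous_cvg; first exact: continuous_expR.
    apply: cvgN; under eq_fun do rewrite -[g x]opprK mulrN.
    by apply: cvg_expRNn; rewrite oppr_gt0.
Qed.

(** A cosine of large period separates the points at distance less than [r]
    from [c] among those within one half-period, and every point is eventually
    within one half-period. *)
Lemma trig_mult_ball (c r : K) : mult (fun x => (`|x - c| < r)%R%:R : K).
Proof.
have [r0|r0] := leP r 0.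
  rewrite (_ : (fun _ => _) = fun=> 0); first exact: trig_mult_cst.
  apply/funext => x; rewrite (_ : (_ < _) = false)//.
  by apply/negbTE; rewrite -leNgt (le_trans r0).
(* on the scale [n.+1] the cosine is decreasing in [|x - c|] as soon as
   [|x - c| <= n.+1 * pi] *)
apply: (@trig_mult_lim _ _ _
  (fun n x => (cos (r / n.+1%:R) +
               - 1 * cos (n.+1%:R^-1 * x + - c / n.+1%:R) < 0)%R%:R) _ 1).
- move=> n; apply: trig_mult_lt0; apply: trig_multD; first exact: trig_mult_cst.
  by apply: trig_multM; [exact: trig_mult_cst|exact: trig_mult_cos].
- by move=> n x; case: (_ < _); rewrite ?normr1// normr0.
- move=> x; apply: cvg_near_cst; near=> n.
  rewrite mulN1r subr_lt0.
  rewrite (_ : n.+1%:R^-1 * x + - c / n.+1%:R = (x - c) / n.+1%:R); last by field.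
  rewrite -[cos ((x - c) / _)]cos_norm normrM normfV [`|n.+1%:R|]ger0_norm//.
  have pi0 : 0 < pi :> K := pi_gt0 K.
  have bnd y : 0 <= y -> y <= n%:R -> y / n.+1%:R \in `[0, (pi : K)].
    move=> y0 yn; rewrite in_itv/= divr_ge0//= ler_pdivrMr//.
    rewrite (le_trans yn)//; rewrite -[leLHS]mul1r ler_pM ?ler_nat//.
    by apply: le_trans (pi_ge2 K); rewrite ler1n.
  rewrite ltr_cos; first by rewrite ltr_pM2r.
  + apply: bnd => //; near: n; exact: nbhs_infty_ger.
  + apply: bnd (ltW r0) _; near: n; exact: nbhs_infty_ger.
Unshelve. all: by end_near. Qed.

Lemma trig_mult_ray (a : K) : mult (fun x => (a < x)%R%:R : K).
Proof.
apply: (@trig_mult_lim _ _ _ (fun n x => (`|x - (a + n%:R)| < n%:R)%R%:R) _ 1).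
- move=> n; exact: trig_mult_ball.
- by move=> n x; case: (_ < _); rewrite ?normr1// normr0.
- move=> x; apply: cvg_near_cst; near=> n.
  have xn : x - a < n%:R by near: n; exact: nbhs_infty_gtr.
  by congr (_%:R); congr nat_of_bool; rewrite ltr_norml; apply/andP/idP; lra.
Unshelve. all: by end_near. Qed.

End trigonometric_multipliers_indicators.

Section charf_injective.
Context (K : realType).
Local Open Scope complex_scope.

Lemma charfE (mu : law K) xi :
  charf mu xi = (\int[mu]_x cos (xi * x)) +i* (\int[mu]_x sin (xi * x)).
Proof.
rewrite /charf /cintegral; congr Complex; apply: eq_Rintegral => v _;
  by rewrite /cexp/= ?(mul0r, mulr0, mul1r, subr0, add0r, addr0, oppr0, expR0).
Qed.

Lemma bdm_sin (a b : K) :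
  bounded_mfun ((fun x => sin (a * x + b)) : measurableTypeR K -> K).
Proof.
have -> : (fun x => sin (a * x + b)) = (fun x => cos (a * x + (b - pi / 2))).
  by apply/funext => x; rewrite addrA cosBpihalf.
exact: bdm_cos.
Qed.

(** Equality of the characteristic functions says that the constant 1 is
    indistinguishable for the two laws, even after multiplication by cosines;
    the multipliers above then show that the two laws agree on rays. *)
Theorem charf_inj (mu1 mu2 : law K) :
  (forall xi, charf mu1 xi = charf mu2 xi) ->
  forall A : set (measurableTypeR K), measurable A -> mu1 A = mu2 A.
Proof.
move=> h.
have one : trig_agree mu1 mu2 (fun=> 1).
  split; first exact: (@bdm_cst _ (measurableTypeR K)).
  move=> a b.
  have E (m : law K) : \int[m]_x (1 * cos (a * x + b)) =
      cos b * \int[m]_x cos (a * x) - sin b * \int[m]_x sin (a * x).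
    have bc : bounded_mfun ((fun x => cos (a * x)) : measurableTypeR K -> K).
      by have := bdm_cos a 0; under eq_fun do rewrite addr0.
    have bs : bounded_mfun ((fun x => sin (a * x)) : measurableTypeR K -> K).
      by have := bdm_sin a 0; under eq_fun do rewrite addr0.
    rewrite -!RintegralZl; [|by []|exact: (bdm_integrable m bs)
                            |by []|exact: (bdm_integrable m bc)].
    rewrite -RintegralB//;
      [|exact: (bdm_integrable m (bdmZ _ bc))|exact: (bdm_integrable m (bdmZ _ bs))].
    by apply: eq_Rintegral => x _; rewrite cosD; ring.
  by have := h a; rewrite !charfE => -[hc hs]; rewrite !E hc hs.
have ray a : mu1 `]a, +oo[%classic = mu2 `]a, +oo[%classic.
  have [_ hr] := trig_mult_ray mu1 mu2 a; have [_ /(_ 0 0) hra] := hr _ one.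
  have E (m : law K) : \int[m]_x (1 * (a < x)%R%:R * cos (0 * x + 0)) =
      fine (m `]a, +oo[%classic).
    have -> : m `]a, +oo[%classic = (\int[m]_x (\1_(`]a, +oo[%classic) x)%:E)%E.
      by rewrite integral_indic// setIT.
    apply: eq_Rintegral => x _; rewrite mul0r addr0 cos0 mulr1 mul1r indicE.
    by rewrite mem_setE in_itv/= andbT.
  rewrite !E in hra.
  by rewrite -[LHS]fineK ?fin_num_measure// hra fineK// fin_num_measure.
apply: (@measure_unique _ _ (measurableTypeR K) (@RGenOInfty.G K)
  (fun n => `](- n%:R)%R, +oo[%classic)).
- exact: RGenOInfty.measurableE.
- move=> _ _ [x ->] [y ->]; exists (Num.max x y).
  by apply/seteqP; split => z /=; rewrite !in_itv/= !andbT gt_max => /andP.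
- by move=> i; eexists.
- apply/seteqP; split => // x _; exists (Num.truncn `|x|).+1 => //=.
  rewrite in_itv/= andbT ltrNl (le_lt_trans (ler_norm _))// normrN.
  exact: truncnS_gt.
- by move=> _ [x ->]; exact: ray.
- move=> k; apply: (le_lt_trans (probability_le1 mu1 _)) => //.
  exact: ltry.
Qed.

End charf_injective.

(** * Real differential calculus *)

Section derive_rules.
Context (K : realType).
Implicit Types (f g : K -> K) (t : K).

Lemma is_derive1_add f g t df dg : is_derive t 1 f df -> is_derive t 1 g dg ->
  is_derive t 1 (fun s => f s + g s) (df + dg).
Proof. exact: is_deriveD. Qed.

Lemma is_derive1_mul f g t df dg : is_derive t 1 f df -> is_derive t 1 g dg ->
  is_derive t 1 (fun s => f s * g s) (df * g t + f t * dg).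
Proof.
move=> hf hg; apply: (is_derive_eq (is_deriveM hf hg)).
by rewrite /GRing.scale/= addrC [g t * _]mulrC.
Qed.

Lemma is_derive1_exp f t df : is_derive t 1 f df ->
  is_derive t 1 (fun s => expR (f s)) (df * expR (f t)).
Proof.
move=> hf; apply: (is_derive_eq (is_derive1_comp _ hf)).
by rewrite /GRing.scale/= mulrC.
Qed.

Lemma is_derive1_expn f n t df : is_derive t 1 f df ->
  is_derive t 1 (fun s => f s ^+ n.+1) (n.+1%:R * df * f t ^+ n).
Proof.
move=> hf; elim: n => [|n ih].
  by under eq_fun do rewrite expr1; rewrite mul1r expr0 mulr1.
under eq_fun do rewrite exprS; apply: (is_derive_eq (is_derive1_mul hf ih)).
by rewrite !exprS -[n.+2]addn1 natrD; ring.
Qed.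

Lemma is_derive1_lin (c : K) t : is_derive t 1 (fun s => c * s) c.
Proof.
apply: (is_derive_eq (is_derive1_mul (is_derive_cst c t 1) (is_derive_id t 1))).
by rewrite mul0r add0r mulr1.
Qed.

Lemma is_derive1_base t : is_derive t 1 (fun s => 1 - expR (- s)) (expR (- t)).
Proof.
have h : is_derive t 1 (fun s => expR (- 1 * s)) (- expR (- t)).
  apply: (is_derive_eq (is_derive1_exp (is_derive1_lin (-1) t))).
  by rewrite !mulN1r.
have -> : (fun s => 1 - expR (- s)) = (fun s : K => 1 + - 1 * expR (- 1 * s)).
  by apply/funext => s; rewrite !mulN1r.
apply: (is_derive_eq (is_derive1_add (is_derive_cst _ _ _)
  (is_derive1_mul (is_derive_cst _ _ _) h))).
by rewrite mul0r !add0r mulN1r opprK.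
Qed.

End derive_rules.

(** * Power series in [1 - exp (- t)] *)

Section wild_sums.
Context (K : realType).
Implicit Types (u v : nat -> K) (t : K).

Lemma sum_triangle (V : nmodType) (F : nat -> nat -> V) N :
  \sum_(n < N) \sum_(j < n.+1) F j (n - j)%N =
  \sum_(j < N) \sum_(k < N - j) F j k.
Proof.
elim: N => [|N ih]; first by rewrite !big_ord0.
rewrite big_ord_recr/= ih [RHS]big_ord_recr/=.
rewrite [X in _ + X]big_ord_recr/= subnn addrA subSnn.
rewrite [\sum_(k < 1) _]big_ord_recr big_ord0/= add0r.
congr (_ + _); rewrite -big_split/=; apply: eq_bigr => j _.
by rewrite subSn ?big_ord_recr// ltnW.
Qed.

(** Partial sums of a power series, at the point [z = 1 - e^(- t)]. In this
    variable [z' = e^(- t) = 1 - z], the kinetic equation becomes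
    [G' = Q(G, G)] for [G = e^t phi], and its solution is a power series whose
    coefficients are given by a convolution; finitely many terms suffice for
    every estimate, so no infinite series is ever differentiated. *)
Definition wsum N u t : K := \sum_(n < N) (1 - expR (- t)) ^+ n * u n.

Lemma wsum_base_ge0 t : 0 <= t -> 0 <= 1 - expR (- t).
Proof. by move=> t0; rewrite subr_ge0 expR_le1 oppr_le0. Qed.

Lemma wsum_ge0 N u t : (forall n, 0 <= u n) -> 0 <= t -> 0 <= wsum N u t.
Proof.
move=> u0 t0; apply: sumr_ge0 => n _.
by rewrite mulr_ge0// exprn_ge0// wsum_base_ge0.
Qed.

Lemma ler_wsum N u v t : (forall n, (n < N)%N -> u n <= v n) -> 0 <= t ->
  wsum N u t <= wsum N v t.
Proof.
move=> uv t0; apply: ler_sum => n _.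
by rewrite ler_wpM2l ?uv// exprn_ge0// wsum_base_ge0.
Qed.

Lemma wsumS N u t :
  wsum N.+1 u t = wsum N u t + (1 - expR (- t)) ^+ N * u N.
Proof. exact: big_ord_recr. Qed.

Lemma wsum_leS N u t : (forall n, 0 <= u n) -> 0 <= t ->
  wsum N u t <= wsum N.+1 u t.
Proof.
move=> u0 t0; rewrite wsumS lerDl mulr_ge0// exprn_ge0// wsum_base_ge0//.
Qed.

Lemma wsumZ N k u t : wsum N (fun n => k * u n) t = k * wsum N u t.
Proof. by rewrite /wsum mulr_sumr; apply: eq_bigr => n _; rewrite mulrCA. Qed.

Lemma wsumD N u v t :
  wsum N (fun n => u n + v n) t = wsum N u t + wsum N v t.
Proof. by rewrite /wsum -big_split; apply: eq_bigr => n _; rewrite mulrDr. Qed.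

Lemma wsum0 N u : wsum N.+1 u 0 = u 0%N.
Proof.
rewrite /wsum big_ord_recl/= expr0 mul1r oppr0 expR0 subrr big1 ?addr0// => i _.
by rewrite expr0n/= mul0r.
Qed.

Lemma wsum1E N t : expR (- t) * wsum N (fun=> 1) t = 1 - (1 - expR (- t)) ^+ N.
Proof.
rewrite /wsum; under eq_bigr do rewrite mulr1.
elim: N => [|N ih]; first by rewrite big_ord0 mulr0 expr0 subrr.
by rewrite big_ord_recr/= mulrDr ih exprS; ring.
Qed.

Lemma wsum1_le N t : 0 <= t -> wsum N (fun=> 1) t <= expR t.
Proof.
move=> t0; rewrite -(ler_pM2l (expR_gt0 (- t))) wsum1E expRN mulVf ?gt_eqF ?expR_gt0//.
by rewrite gerBl exprn_ge0// -expRN wsum_base_ge0.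
Qed.

(** All the terms are nonnegative, and the sum on the left is over a triangle
    of indices contained in the square described by the product. *)
Lemma wsum_conv_le N u v t : (forall n, 0 <= u n) -> (forall n, 0 <= v n) ->
  0 <= t -> wsum N (fun n => \sum_(j < n.+1) u j * v (n - j)%N) t <=
            wsum N u t * wsum N v t.
Proof.
move=> u0 v0 t0; set z := 1 - expR (- t); have z0 := wsum_base_ge0 t0.
rewrite /wsum -/z.
rewrite [leLHS](_ : _ = \sum_(n < N) \sum_(j < n.+1)
    (z ^+ j * u j) * (z ^+ (n - j) * v (n - j)%N)); last first.
  apply: eq_bigr => n _; rewrite mulr_sumr; apply: eq_bigr => j _.
  by rewrite mulrACA -exprD subnKC// -ltnS.
rewrite (@sum_triangle _ (fun j k => (z ^+ j * u j) * (z ^+ k * v k))).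
rewrite mulr_suml; apply: ler_sum => j _.
rewrite -mulr_sumr ler_wpM2l ?mulr_ge0 ?exprn_ge0//.
rewrite -!(big_mkord xpredT (fun k => z ^+ k * v k)).
rewrite [leRHS](@big_cat_nat _ _ _ (N - j)%N)//= ?leq_subr// lerDl.
by apply: sumr_ge0 => k _; rewrite mulr_ge0 ?exprn_ge0.
Qed.

Lemma is_derive_wsum N u t :
  is_derive t 1 (wsum N.+1 u)
    (expR (- t) * wsum N (fun n => n.+1%:R * u n.+1) t).
Proof.
elim: N => [|N ih].
  rewrite /wsum big_ord0 mulr0 (_ : (fun _ => _) = fun=> u 0%N).
    exact: is_derive_cst.
  by apply/funext => s; rewrite big_ord_recl/= big_ord0 addr0 expr0 mul1r.
rewrite wsumS (_ : wsum N.+2 u = (fun s => wsum N.+1 u s +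
   (1 - expR (- s)) ^+ N.+1 * u N.+1)); last first.
  by apply/funext => s; rewrite wsumS.
apply: (is_derive_eq (is_derive1_add ih (is_derive1_mul
  (is_derive1_expn N (is_derive1_base t)) (is_derive_cst _ _ _)))).
by rewrite /cst; ring.
Qed.

Lemma half_line_nincr (f df : K -> K) :
  {within `[0, +oo[, continuous f} ->
  (forall t, 0 < t -> is_derive t 1 f (df t)) ->
  (forall t, 0 < t -> df t <= 0) -> forall t, 0 <= t -> f t <= f 0.
Proof.
move=> cf fd df0 t; rewrite le_eqVlt => /predU1P[<-//|t0].
have [||c c0t] := @MVT K f df 0 t t0.
- by move=> x; rewrite in_itv/= => /andP[x0 _]; exact: fd.
- apply: continuous_subspaceW cf => x/=; rewrite !in_itv/= andbT.
  by case/andP.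
- move: c0t; rewrite in_itv/= subr0 => /andP[c0 _] ft.
  by rewrite -subr_le0 ft mulr_le0_ge0 ?df0// ltW.
Qed.

End wild_sums.

(** * Growth of the moments along Wild sums *)

Section moment_growth.
Context (K : realType).

Lemma is_derive_within (f df : K -> K) :
  (forall t : K, 0 <= t -> is_derive t 1 f (df t)) ->
  {within `[0, +oo[, continuous f}.
Proof.
move=> fd; apply: continuous_in_subspaceT => t; rewrite mem_setE in_itv/= andbT.
move=> t0; apply: differentiable_continuous; apply/derivable1_diffP.
by have [] := fd t t0.
Qed.

(** The order of magnitude of the solutions of [M' = phip M + k e^(phi1 t)];
    a factor [t] is produced exactly by the resonance [phi1 = phip]. *)
Definition mixed_rate (phi1 phip t : K) : K :=
  if phip == phi1 then Num.max 1 t * expR (t * Num.max phi1 phip)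
  else expR (t * Num.max phi1 phip).

(** [H] is the primitive that variation of constants brings in. *)
Lemma mixed_rate_bound (phi1 phip k : K) : 0 <= k ->
  exists H : K -> K, [/\ H 0 = 0,
    forall t : K, is_derive t 1 H (k * expR ((phi1 - phip) * t)) &
    exists2 C, 0 <= C & forall t, 0 <= t ->
      H t * expR (phip * t) <= C * mixed_rate phi1 phip t].
Proof.
move=> k0; rewrite /mixed_rate; case: eqVneq => [->|ne].
  exists (fun s => k * s); split; first exact: mulr0.
    by move=> t; apply: (is_derive_eq (is_derive1_lin k t));
      rewrite subrr mul0r expR0 mulr1.
  exists k => // t t0; rewrite -mulrA ler_wpM2l// maxxx [phi1 * t]mulrC.
  by rewrite ler_wpM2r ?expR_ge0// le_max lexx orbT.
set d := phi1 - phip; have d0 : d != 0 by rewrite subr_eq0 eq_sym.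
exists (fun s => k / d * (expR (d * s) + - 1)); split.
- by rewrite mulr0 expR0 subrr mulr0.
- move=> t; apply: (is_derive_eq (is_derive1_mul (is_derive_cst _ _ _)
   (is_derive1_add (is_derive1_exp (is_derive1_lin d t)) (is_derive_cst _ _ _)))).
  by rewrite mul0r add0r addr0 mulrA divfK.
- exists (k / `|d|); first by rewrite divr_ge0.
  move=> t t0.
  have -> : k / d * (expR (d * t) + - 1) * expR (phip * t) =
      k / d * (expR (t * phi1) - expR (t * phip)).
    rewrite -mulrA mulrBl mul1r -expRD; congr (_ * (expR _ - expR _)).
      by rewrite /d; ring.
    exact: mulrC.
  move: d0; rewrite neq_lt => /orP[] d1.
  + have h : phi1 < phip by rewrite -subr_lt0.
    rewrite ltr0_norm// (max_idPr (ltW h)).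
    have -> : k / d * (expR (t * phi1) - expR (t * phip)) =
        k / - d * (expR (t * phip) - expR (t * phi1)) by rewrite invrN; ring.
    rewrite ler_wpM2l ?divr_ge0 ?oppr_ge0 ?(ltW d1)//.
    by rewrite gerBl expR_ge0.
  + have h : phip < phi1 by rewrite -subr_gt0.
    rewrite gtr0_norm// (max_idPl (ltW h)) ler_wpM2l ?divr_ge0 ?(ltW d1)//.
    by rewrite gerBl expR_ge0.
Qed.

Variables (p e1 ep k : K) (a b c : nat -> K).
Hypotheses (p1 : 1 < p) (e1_ge0 : 0 <= e1) (ep_ge0 : 0 <= ep) (k_ge0 : 0 <= k).
Hypotheses (a0 : forall n, 0 <= a n) (b0 : forall n, 0 <= b n)
  (c0 : forall n, 0 <= c n).
Hypothesis aS : forall n, n.+1%:R * a n.+1 <= e1 * \sum_(j < n.+1) a j.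
Hypothesis bS : forall n, n.+1%:R * b n.+1 <=
  ep * \sum_(j < n.+1) b j + k * \sum_(j < n.+1) c j * a (n - j)%N.
Hypothesis cb : forall n (s : K), c n <= expR (- (p - 1) * s) + expR s * b n.

Lemma wsum_sum_le (u : nat -> K) N (t : K) : (forall n, 0 <= u n) -> 0 <= t ->
  wsum N (fun n => \sum_(j < n.+1) u j) t <= expR t * wsum N u t.
Proof.
move=> u0 t0.
have -> : (fun n => \sum_(j < n.+1) u j) =
    (fun n => \sum_(j < n.+1) u j * (fun=> 1) (n - j)%N).
  by apply/funext => n; apply: eq_bigr => j _; rewrite mulr1.
have h := @wsum_conv_le _ N u (fun=> 1) t u0 (fun=> ler01) t0.
by apply: (le_trans h); rewrite mulrC ler_wpM2r ?wsum_ge0// wsum1_le.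
Qed.

(** Gronwall: the recursion makes [e1] times the sum itself a bound for its
    derivative, because the sums of the powers of [z] are at most [e^s]. *)
Lemma wsum_first_moment N (t : K) : 0 <= t -> wsum N.+1 a t <= a 0%N * expR (e1 * t).
Proof.
move=> t0; pose f (s : K) := wsum N.+1 a s * expR (- e1 * s).
pose df s := expR (- s) * wsum N (fun n => n.+1%:R * a n.+1) s * expR (- e1 * s)
  + wsum N.+1 a s * (- e1 * expR (- e1 * s)).
have fd (s : K) : is_derive s 1 f (df s).
  apply: is_derive1_mul; first exact: is_derive_wsum.
  exact: is_derive1_exp (is_derive1_lin _ _).
have := @half_line_nincr _ f df (is_derive_within (fun s _ => fd s)) (fun s _ => fd s).
move=> /(_ _ t t0); rewrite /f wsum0 mulr0 expR0 mulr1 => h.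
rewrite -[leLHS]mulr1 -(@mulVf _ (expR (e1 * t))) ?gt_eqF ?expR_gt0//.
rewrite mulrA ler_wpM2r ?expR_ge0// -expRN -mulNr; apply: h => s s0.
have {}s0 := ltW s0.
rewrite /df [X in _ + X]mulrA -mulrDl mulr_le0_ge0 ?expR_ge0//.
rewrite mulrN subr_le0 -(ler_pM2l (expR_gt0 s)) mulrA -expRD subrr expR0 mul1r.
apply: (le_trans (ler_wsum (v := fun n => e1 * \sum_(j < n.+1) a j) _ s0)) => //.
rewrite wsumZ mulrA [leRHS]mulrC ler_wpM2l//.
apply: (le_trans (wsum_sum_le _ a0 s0)).
by rewrite ler_wpM2l ?expR_ge0// wsum_leS.
Qed.

(** The hypothesis [cb], optimised over its parameter: with
    [V = 1 + wsum b] and [M] the [p]-th root of [e^(- s) V], the bound reads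
    [e^(- s) wsum c <= 2 M^(p - 1)], as Jensen's inequality would give. *)
Lemma wsum_cross_le N (s : K) : 0 <= s ->
  wsum N.+1 c s <= 2 * expR (s / p) * (1 + wsum N.+1 b s) /
                   expR (ln (1 + wsum N.+1 b s) / p).
Proof.
move=> s0; set V := 1 + _; have V0 : 0 < V by rewrite ltr_pwDl ?wsum_ge0.
have p0 : 0 < p by rewrite (lt_trans ltr01).
(* this [x] makes the two terms of the hypothesis [cb] contribute equally *)
set x := (s - ln V) / p.
apply: (le_trans (ler_wsum (fun n _ => cb n x) s0)).
rewrite wsumD wsumZ.
have -> : (fun=> expR (- (p - 1) * x)) = (fun=> expR (- (p - 1) * x) * 1) :> (nat -> K).
  by apply/funext => n; rewrite mulr1.
rewrite wsumZ.
have -> : 2 * expR (s / p) * V / expR (ln V / p) =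
    expR (- (p - 1) * x) * expR s + expR x * V.
  rewrite -expRN -{1 3}[V]lnK ?posrE//.
  rewrite -!mulrA -!expRD.
  have -> : - (p - 1) * x + s = s / p + (ln V + - (ln V / p)).
    by rewrite /x; field; rewrite gt_eqF.
  have -> : x + ln V = s / p + (ln V + - (ln V / p)).
    by rewrite /x; field; rewrite gt_eqF.
  by rewrite mulr_natl mulr2n.
apply: lerD; rewrite ler_wpM2l ?expR_ge0//; first exact: wsum1_le.
by rewrite lerDr.
Qed.

(** Let [M] be the [p]-th root of [e^(- t)] times the sum of the moments of
    order [p]. The recursion gives
    [(M^p)' <= (ep - 1) M^p + k' e^(phi1 t) M^(p - 1)], that is
    [M' <= phip M + k'' e^(phi1 t)], for every [p > 1]: the linear inequality
    which [mixed_rate] solves. *)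
Lemma wsum_moment_growth : exists2 C, 0 <= C & forall N (t : K), 0 <= t ->
  expR (- t) * wsum N b t <=
  (C * mixed_rate (e1 - 1) ((ep - 1) / p) t) `^ p.
Proof.
have p0 : 0 < p by rewrite (lt_trans ltr01).
set phi1 := e1 - 1; set phip := (ep - 1) / p.
pose k' := 2 * k * a 0%N / p.
have k'0 : 0 <= k' by rewrite divr_ge0 ?mulr_ge0// ltW.
have [H [H0 dH [C C0 HC]]] := mixed_rate_bound phi1 phip k'0.
pose G0 := expR (ln (1 + b 0%N) / p).
exists (G0 + C); first by rewrite addr_ge0// expR_ge0.
suff main N (t : K) : 0 <= t -> expR (- t) * wsum N.+1 b t <=
    ((G0 + C) * mixed_rate phi1 phip t) `^ p.
  move=> N t t0; apply: le_trans (main N t t0).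
  by rewrite ler_wpM2l ?expR_ge0// wsum_leS.
move=> t0.
(* the added 1 keeps [V] positive, so that its root can be differentiated *)
pose V s := 1 + wsum N.+1 b s.
have V0 (s : K) : 0 <= s -> 0 < V s by move=> s0; rewrite ltr_pwDl ?wsum_ge0.
pose dV s := expR (- s) * wsum N (fun n => n.+1%:R * b n.+1) s.
have dVE (s : K) : is_derive s 1 V (dV s).
  apply: (is_derive_eq (is_derive1_add (is_derive_cst _ _ _)
    (is_derive_wsum N b s))); exact: add0r.
(* [G = e^(- phip s) M]: the integrating factor removes the linear term *)
pose G s := expR (p^-1 * ln (V s) + - (ep / p) * s).
pose dG s := (p^-1 * (dV s / V s) + - (ep / p)) * G s.
have dGE (s : K) : 0 <= s -> is_derive s 1 G (dG s).
  move=> s0; apply: is_derive1_exp.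
  have dln : is_derive s 1 (fun r => ln (V r)) (dV s / V s).
    by rewrite mulrC; apply: is_derive1_comp; exact/is_derive1_ln/V0.
  apply: (is_derive_eq (is_derive1_add (is_derive1_mul (is_derive_cst _ _ _) dln)
    (is_derive1_lin _ _))).
  by rewrite mul0r add0r.
have dVle (s : K) : 0 <= s -> dV s <= ep * V s + k * expR (- s) *
    (2 * expR (s / p) * V s / expR (ln (V s) / p)) * (a 0%N * expR (e1 * s)).
  move=> s0.
  have W1 : wsum N (fun n => n.+1%:R * b n.+1) s <=
      ep * (expR s * wsum N b s) + k * (wsum N c s * wsum N a s).
    apply: (le_trans (ler_wsum (fun n _ => bS n) s0)).
    rewrite wsumD !wsumZ lerD// ler_wpM2l ?wsum_sum_le//.
    exact: wsum_conv_le.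
  rewrite /dV; apply: (le_trans (ler_wpM2l (expR_ge0 _) W1)).
  rewrite mulrDr mulrCA [expR (- s) * (expR s * _)]mulrA -expRD addNr expR0 mul1r lerD//.
    rewrite ler_wpM2l// (le_trans (wsum_leS _ b0 s0))// lerDr//.
  rewrite mulrCA -!(mulrA k) ler_wpM2l// -mulrA ler_wpM2l ?expR_ge0//.
  rewrite ler_pM ?wsum_ge0//.
    by apply: le_trans (wsum_cross_le N s0); exact: wsum_leS.
  by apply: le_trans (wsum_first_moment N s0); exact: wsum_leS.
have dGle (s : K) : 0 <= s -> dG s <= k' * expR ((phi1 - phip) * s).
  move=> s0; have Vs := V0 s s0.
  have -> : k' * expR ((phi1 - phip) * s) = p^-1 * (k * expR (- s) *
    (2 * expR (s / p) / expR (ln (V s) / p)) * (a 0%N * expR (e1 * s))) * G s.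
    rewrite /k' /G -expRN.
    rewrite (_ : (phi1 - phip) * s = - s + s / p - ln (V s) / p + e1 * s +
       (p^-1 * ln (V s) + - (ep / p) * s)); last first.
      by rewrite /phi1 /phip; field; rewrite gt_eqF.
    rewrite !expRD; ring.
  rewrite ler_wpM2r ?expR_ge0//.
  rewrite [ep / p]mulrC -mulrN -mulrDr ler_wpM2l ?invr_ge0 ?(ltW p0)//.
  rewrite lerBlDr ler_pdivrMr// (le_trans (dVle s s0))//.
  by rewrite le_eqVlt; apply/orP; left; apply/eqP; ring.
have := @half_line_nincr _ (fun s => G s + - 1 * H s)
  (fun s => dG s + (0 * H s + - 1 * (k' * expR ((phi1 - phip) * s)))).
have D (s : K) : 0 <= s -> is_derive s 1 (fun s => G s + - 1 * H s)
  (dG s + (0 * H s + - 1 * (k' * expR ((phi1 - phip) * s)))).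
  move=> s0; apply: is_derive1_add (dGE s s0) _.
  exact: is_derive1_mul (is_derive_cst _ _ _) (dH s).
move=> /(_ (is_derive_within D) (fun s s0 => D s (ltW s0)) _ t t0) h.
have {}h : G t <= G0 + H t.
  rewrite -lerBlDr -[- H t]mulN1r; apply: le_trans (h _) _ => [s s0|].
    by rewrite mul0r add0r mulN1r subr_le0 dGle// ltW.
  by rewrite H0 mulr0 addr0 /G /V wsum0 mulr0 addr0 mulrC.
have GE : expR (- t) * V t = (G t * expR (phip * t)) `^ p.
  rewrite [G t]/(expR _) -expRD -expRM -{1}[V t]lnK ?posrE ?V0// -expRD.
  congr expR.
  by rewrite /phip; field; rewrite gt_eqF.
apply: (@le_trans _ _ (expR (- t) * V t)).
  by rewrite ler_wpM2l ?expR_ge0// lerDr.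
have e_le : expR (phip * t) <= mixed_rate phi1 phip t.
  have h1 : expR (phip * t) <= expR (t * Num.max phi1 phip).
    by rewrite ler_expR mulrC ler_wpM2l// le_max lexx orbT.
  rewrite /mixed_rate; case: ifP => // _; apply: (le_trans h1).
  by rewrite ler_peMl ?expR_ge0// le_max lexx.
rewrite GE ge0_ler_powR ?(ltW p0)// ?nnegrE.
- by rewrite mulr_ge0 ?expR_ge0.
- by rewrite mulr_ge0 ?addr_ge0 ?expR_ge0// (le_trans _ e_le) ?expR_ge0.
- apply: (le_trans (ler_wpM2r (expR_ge0 _) h)).
  by rewrite mulrDl [leRHS]mulrDl lerD ?HC// ler_wpM2l ?expR_ge0.
Qed.

End moment_growth.

(** * Mixtures and smoothing of probability measures *)

Section mixtures.
Context d (T : measurableType d) (K : realType).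

(** Identities are available for nonnegative functions first; adding a
    constant transfers them to bounded ones. *)
Lemma Rintegral_shift (m : probability T K) (f : T -> K) (M : K) : bounded_mfun f ->
  (\int[m]_x (f x + M)%:E = (\int[m]_x f x + M)%:E)%E.
Proof.
move=> bf; have bM := bdm_cst T M.
have i := bdm_integrable m (bdmD bf bM).
rewrite -[LHS]fineK; last exact: integrable_fin_num.
congr EFin; rewrite -/(Rintegral _ _ _) RintegralD//; [|exact: bdm_integrable..].
by rewrite Rintegral_cst// [X in fine X](probability_setT m)/= mulr1.
Qed.

Lemma nneseries_finite (g : nat -> \bar K) N : (forall n, 0 <= g n)%E ->
  (forall n, (N <= n)%N -> g n = 0%E) ->
  (\sum_(n <oo) g n = \sum_(n < N) g n)%E.
Proof.
move=> g0 gN; rewrite (nneseries_split 0 N)//= add0n big_mkord eseries0 ?adde0//.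
by move=> n Nn _; exact: gN.
Qed.

Lemma mixture_exists (w : nat -> K) (m : nat -> probability T K) :
  (forall n, 0 <= w n) -> (\sum_(n <oo) (w n)%:E = 1)%E ->
  exists Q : probability T K, forall f : T -> \bar K,
    measurable_fun setT f -> (forall x, 0 <= f x)%E ->
    (\int[Q]_x f x = \sum_(n <oo) (w n)%:E * \int[m n]_x f x)%E.
Proof.
move=> w0 w1.
pose ms n := mscale (NngNum (w0 n)) (m n).
pose mu := mseries ms 0.
have mu1 : mu setT = 1%E.
  rewrite /mu /mseries/= -w1; apply: eq_eseriesr => n _.
  by rewrite /ms /mscale/= [X in (_ * X)%E](probability_setT (m n)) mule1.
pose Q : probability T K := HB.pack_for (probability T K) (mseries ms 0)
  (Measure_isProbability.Build _ _ _ (mseries ms 0) mu1).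
exists Q => f mf f0.
rewrite [LHS](_ : _ = \int[mu]_x f x)%E//.
rewrite ge0_integral_measure_series//; apply: eq_eseriesr => n _.
by rewrite ge0_integral_mscale.
Qed.

(** Multiplying by the number of terms instead of dividing keeps the
    identities that follow free of inverses of extended reals. *)
Lemma average_exists N (m : nat -> probability T K) :
  exists Q : probability T K, forall f : T -> \bar K,
    measurable_fun setT f -> (forall x, 0 <= f x)%E ->
    (N.+1%:R%:E * \int[Q]_x f x = \sum_(n < N.+1) \int[m n]_x f x)%E.
Proof.
pose w n : K := if (n < N.+1)%N then N.+1%:R^-1 else 0.
have w0 n : 0 <= w n by rewrite /w; case: ifP => // _; rewrite invr_ge0.
have [||Q HQ] := @mixture_exists w m => //.
  rewrite (@nneseries_finite _ N.+1); last 2 first.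
  - by move=> n; rewrite lee_fin.
  - by move=> n Nn; rewrite /w ltnNge Nn.
  rewrite sumEFin; congr EFin; under eq_bigr do rewrite /w ltn_ord.
  by rewrite sumr_const card_ord -[LHS]mulr_natr mulVf.
exists Q => f mf f0; rewrite HQ// (@nneseries_finite _ N.+1); last 2 first.
- by move=> n; rewrite mule_ge0 ?lee_fin// integral_ge0.
- by move=> n Nn; rewrite /w ltnNge Nn mul0e.
rewrite ge0_sume_distrr; last first.
  by move=> n _; rewrite mule_ge0 ?lee_fin// integral_ge0.
by apply: eq_bigr => n _; rewrite /w ltn_ord muleA -EFinM mulfV ?mul1e.
Qed.

Lemma bdm_ge0_shift (f : T -> K) : bounded_mfun f ->
  exists M, forall x, (0 <= (f x + M)%:E)%E.
Proof.
move=> [_ [M fM]]; exists M => x; rewrite lee_fin -lerBlDr sub0r.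
by have := fM x; rewrite ler_norml => /andP[].
Qed.

End mixtures.

Section strong_recursion.

(** The term chosen at stage [n + 1] depends on all the terms already chosen.
    As [Good n] reads only the first [n + 1] values of its history, the
    histories can be extended one value at a time and glued along the
    diagonal. *)
Lemma history_exists (A : Type) (a0 : A) (Good : nat -> (nat -> A) -> A -> Prop) :
  (forall n h, exists x, Good n h x) ->
  (forall n h h' x, (forall k, (k <= n)%N -> h k = h' k) ->
     Good n h x -> Good n h' x) ->
  exists rho : nat -> A, rho 0%N = a0 /\ forall n, Good n rho (rho n.+1).
Proof.
move=> ex loc.
have /choice[F HF] (nh : nat * (nat -> A)) : exists x, Good nh.1 nh.2 x by exact: ex.
pose hist := fix hist n := if n is n'.+1 then
  fun k => if (k <= n')%N then hist n' k else F (n', hist n') else fun=> a0.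
have histE n k : (k <= n)%N -> hist n k = hist k k.
  elim: n k => [|n ih] k; first by rewrite leqn0 => /eqP ->.
  rewrite leq_eqVlt => /predU1P[->//|]; rewrite ltnS => kn /=.
  by rewrite kn ih.
exists (fun n => hist n n); split=> // n.
rewrite /= ltnn; apply: loc (HF (n, hist n)) => k kn /=; exact: histE.
Qed.

End strong_recursion.

(** * Fubini's theorem for bounded functions *)

Section bounded_fubini.
Context (K : realType).

Lemma Rintegral_bounded d (T : measurableType d) (m : probability T K)
    (f : T -> K) (M : K) : measurable_fun setT f -> (forall x, `|f x| <= M) ->
  `|\int[m]_x f x| <= M.
Proof.
move=> mf fM; have bf : bounded_mfun f by split=> //; exists M.
have i := bdm_integrable m bf.
apply: (le_trans (le_normr_Rintegral measurableT i)).
have -> : M = \int[m]_x M.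
  by rewrite Rintegral_cst// [X in fine X](probability_setT m)/= mulr1.
apply: le_Rintegral => //; last exact: bdm_integrable (bdm_cst T M).
by apply: (bdm_integrable m (f := fun x => `|f x|)); split;
  [exact: measurableT_comp|exists M => x; rewrite normr_id].
Qed.

Context d1 d2 (X : measurableType d1) (Y : measurableType d2)
  (m1 : probability X K) (m2 : probability Y K).

Lemma bdm_section (h : X * Y -> K) x : bounded_mfun h -> bounded_mfun (fun y => h (x, y)).
Proof. by apply: bdm_comp; exact: measurable_pair1. Qed.

Lemma Rintegral_section (h : X * Y -> K) x : bounded_mfun h ->
  fubini_F m2 (EFin \o h) x = (\int[m2]_y h (x, y))%:E.
Proof.
move=> bh; rewrite /fubini_F fineK//; apply: integrable_fin_num => //.
exact: bdm_integrable (bdm_section x bh).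
Qed.

Lemma bdm_Rintegral (h : X * Y -> K) :
  bounded_mfun h -> bounded_mfun (fun x => \int[m2]_y h (x, y)).
Proof.
move=> bh; have i := bdm_integrable ((m1 \x m2)%E : probability (X * Y)%type K) bh; split.
  apply/measurable_EFinP; have := measurable_fubini_F i.
  by congr measurable_fun; apply/funext => x; exact: Rintegral_section.
have [_ [M hM]] := bh; exists M => x; apply: Rintegral_bounded => //.
exact: (bdm_section x bh).1.
Qed.

Lemma Rintegral_prod (h : X * Y -> K) : bounded_mfun h ->
  \int[(m1 \x m2)%E]_q h q = \int[m1]_x \int[m2]_y h (x, y).
Proof.
move=> bh; have i := bdm_integrable ((m1 \x m2)%E : probability (X * Y)%type K) bh.
rewrite /Rintegral -(integral12_prod_meas1 i); congr fine.
by apply: eq_integral => x _; exact: Rintegral_section.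
Qed.

End bounded_fubini.

Definition triple_law (K : realType) d d' (T : measurableType d)
    (Z : measurableType d') (P : probability T K) (m m' : probability Z K) :
  probability (T * (Z * Z))%type K := (P \x (m \x m'))%E.

Section complex_fubini.
Context (K : realType).
Local Open Scope complex_scope.

Definition cbounded_mfun d (T : measurableType d) (f : T -> K[i]) :=
  bounded_mfun (fun x => complex.Re (f x)) /\ bounded_mfun (fun x => complex.Im (f x)).

Context d d' (T : measurableType d) (Z : measurableType d')
  (P : probability T K) (m m' : probability Z K).

Lemma Rintegral_prod_mul (f g : T * Z -> K) : bounded_mfun f -> bounded_mfun g ->
  \int[P]_w (\int[m]_z f (w, z) * \int[m']_z g (w, z)) =
  \int[triple_law P m m']_q (f (q.1, q.2.1) * g (q.1, q.2.2)).
Proof.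
move=> bf bg.
have bh : bounded_mfun (fun q : T * (Z * Z) => f (q.1, q.2.1) * g (q.1, q.2.2)).
  apply: bdmM.
    apply: (bdm_comp (h := fun q : T * (Z * Z) => (q.1, q.2.1))) bf.
    apply: measurable_fun_pair; first exact: measurable_fst.
    by apply: measurableT_comp; [exact: measurable_fst|exact: measurable_snd].
  apply: (bdm_comp (h := fun q : T * (Z * Z) => (q.1, q.2.2))) bg.
  apply: measurable_fun_pair; first exact: measurable_fst.
  by apply: measurableT_comp; [exact: measurable_snd|exact: measurable_snd].
rewrite (Rintegral_prod P (m \x m')%E bh); apply: eq_Rintegral => w _.
rewrite (Rintegral_prod m m' (bdm_section w bh))/=.
rewrite -RintegralZr//; last exact: bdm_integrable (bdm_section w bf).
apply: eq_Rintegral => z _.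
by rewrite -RintegralZl//; exact: bdm_integrable (bdm_section w bg).
Qed.

(** For fixed [w] the product of the two integrals is an integral over the
    product space, so that the mean of a product of transforms becomes one
    integral against the joint law. *)
Lemma cintegral_prod_mul (F G : T * Z -> K[i]) : cbounded_mfun F -> cbounded_mfun G ->
  cintegral P setT (fun w => cintegral m setT (fun z => F (w, z)) *
                             cintegral m' setT (fun z => G (w, z))) =
  cintegral (triple_law P m m') setT
    (fun q => F (q.1, q.2.1) * G (q.1, q.2.2)).
Proof.
move=> [bF1 bF2] [bG1 bG2].
have bI (m0 : probability Z K) (f : T * Z -> K) : bounded_mfun f ->
    bounded_mfun (fun w => \int[m0]_z f (w, z)) by move=> bf; exact: (bdm_Rintegral P).
have iP (f g : T * Z -> K) : bounded_mfun f -> bounded_mfun g -> P.-integrable setT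
    (EFin \o (fun w => \int[m]_z f (w, z) * \int[m']_z g (w, z))).
  by move=> bf bg; apply/bdm_integrable/bdmM; exact: bI.
have iQ (f g : T * Z -> K) : bounded_mfun f -> bounded_mfun g ->
    (triple_law P m m').-integrable setT
    (EFin \o (fun q => f (q.1, q.2.1) * g (q.1, q.2.2))).
  move=> bf bg; apply/bdm_integrable/bdmM.
    apply: (bdm_comp (h := fun q : T * (Z * Z) => (q.1, q.2.1))) bf.
    apply: measurable_fun_pair; first exact: measurable_fst.
    by apply: measurableT_comp; [exact: measurable_fst|exact: measurable_snd].
  apply: (bdm_comp (h := fun q : T * (Z * Z) => (q.1, q.2.2))) bg.
  apply: measurable_fun_pair; first exact: measurable_fst.
  by apply: measurableT_comp; [exact: measurable_snd|exact: measurable_snd].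
rewrite /cintegral; congr Complex.
- transitivity (\int[P]_w
    (\int[m]_z complex.Re (F (w, z)) * \int[m']_z complex.Re (G (w, z)) -
     \int[m]_z complex.Im (F (w, z)) * \int[m']_z complex.Im (G (w, z)))).
    by apply: eq_Rintegral => w _.
  rewrite RintegralB//; [|exact: (iP _ _ bF1 bG1)|exact: (iP _ _ bF2 bG2)].
  rewrite (Rintegral_prod_mul bF1 bG1) (Rintegral_prod_mul bF2 bG2).
  rewrite -RintegralB//; [|exact: (iQ _ _ bF1 bG1)|exact: (iQ _ _ bF2 bG2)].
  by apply: eq_Rintegral => q _; case: (F _) => a b; case: (G _).
- transitivity (\int[P]_w
    (\int[m]_z complex.Re (F (w, z)) * \int[m']_z complex.Im (G (w, z)) +
     \int[m]_z complex.Im (F (w, z)) * \int[m']_z complex.Re (G (w, z)))).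
    by apply: eq_Rintegral => w _.
  rewrite RintegralD//; [|exact: (iP _ _ bF1 bG2)|exact: (iP _ _ bF2 bG1)].
  rewrite (Rintegral_prod_mul bF1 bG2) (Rintegral_prod_mul bF2 bG1).
  rewrite -RintegralD//; [|exact: (iQ _ _ bF1 bG2)|exact: (iQ _ _ bF2 bG1)].
  by apply: eq_Rintegral => q _; case: (F _) => a b; case: (G _).
Qed.

End complex_fubini.

(** * Smoothing and Fourier-Laplace transforms *)

Section complex_exponential.
Context (K : realType).
Local Open Scope complex_scope.
Implicit Types (c u v : K[i]) (x : K).

Lemma cexpD u v : cexp (u + v) = cexp u * cexp v.
Proof.
case: u => a b; case: v => a' b'; rewrite /cexp/= expRD cosD sinD.
by apply/eqP; rewrite eq_complex/=; apply/andP; split; apply/eqP; ring.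
Qed.

Lemma cexpE c x : cexp (c * x%:C) =
  (expR (complex.Re c * x) * cos (complex.Im c * x)) +i*
  (expR (complex.Re c * x) * sin (complex.Im c * x)).
Proof.
case: c => a b; rewrite /cexp/=.
rewrite !mulr0 !subr0 !add0r; apply/eqP; rewrite eq_complex/=.
by rewrite !mul0r subr0 !addr0 !eqxx.
Qed.

Lemma cbdm_cexp d (Z : measurableType d) c (Y : Z -> K) :
  measurable_fun setT Y -> (forall z, complex.Re c * Y z <= 0) ->
  cbounded_mfun (fun z => cexp (c * (Y z)%:C)).
Proof.
move=> mY cY.
have mc k : measurable_fun setT (fun z => k * Y z) by exact: measurable_funM.
have e1 z : `|expR (complex.Re c * Y z)| <= 1.
  by rewrite ger0_norm ?expR_ge0// expR_le1.
have me : measurable_fun setT (fun z => expR (complex.Re c * Y z)).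
  exact: measurableT_comp (mc _).
split; split.
- under eq_fun do rewrite cexpE/=; apply: measurable_funM => //.
  apply: measurableT_comp (mc _).
  by apply: continuous_measurable_fun; exact: continuous_cos.
- by exists 1 => z; rewrite cexpE/= normrM mulr_ile1// cos_max.
- under eq_fun do rewrite cexpE/=; apply: measurable_funM => //.
  apply: measurableT_comp (mc _).
  by apply: continuous_measurable_fun; exact: continuous_sin.
- by exists 1 => z; rewrite cexpE/= normrM mulr_ile1// sin_max.
Qed.

Lemma eq_cintegral d (Z : measurableType d) (m : probability Z K)
    (F G : Z -> K[i]) :
  F =1 G -> cintegral m setT F = cintegral m setT G.
Proof. by move=> /funext ->. Qed.

(** One transform serves for characteristic functions (imaginary [c]) and for
    the Laplace transforms with complex rate that define the steady state. *)
Definition laplace d (Z : measurableType d) (m : probability Z K) (X : Z -> K) c :=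
  cintegral m setT (fun z => cexp (c * (X z)%:C)).

Lemma charf_laplace (mu : law K) xi :
  charf mu xi = laplace mu id ('i%C * xi%:C).
Proof.
by apply: eq_cintegral => v; rewrite -mulrA -rmorphM.
Qed.

Lemma Re_i_real x : complex.Re ('i%C * x%:C) = 0.
Proof. by rewrite /= mul0r mulr0 subrr. Qed.

Lemma Rintegral_distribution d d' (Z : measurableType d) (Y : measurableType d')
    (m : probability Z K) (X : {mfun Z >-> Y}) (f : Y -> K) : bounded_mfun f ->
  \int[distribution m X]_y f y = \int[m]_z f (X z).
Proof.
move=> bf; rewrite /Rintegral; congr fine.
rewrite (@integral_distribution _ _ _ _ _ m X (EFin \o f))//.
  exact/measurable_EFinP/bf.1.
exact: (bdm_integrable m (bdm_comp (measurable_funPT X) bf)).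
Qed.

Lemma cintegral_distribution d d' (Z : measurableType d) (Y : measurableType d')
    (m : probability Z K) (X : {mfun Z >-> Y}) (F : Y -> K[i]) : cbounded_mfun F ->
  cintegral (distribution m X) setT F = cintegral m setT (fun z => F (X z)).
Proof.
by move=> [b1 b2]; rewrite /cintegral (Rintegral_distribution m X b1)
  (Rintegral_distribution m X b2).
Qed.

Lemma charf_distribution d (Z : measurableType d) (m : probability Z K)
    (X : {mfun Z >-> measurableTypeR K}) xi :
  charf (distribution m X) xi = laplace m X ('i%C * xi%:C).
Proof.
rewrite charf_laplace /laplace cintegral_distribution//.
apply: (@cbdm_cexp _ (measurableTypeR K)) => // z.
by rewrite Re_i_real mul0r.
Qed.

(** Independence turns the transform of [A X + B X'] into the mean of the
    product of the transforms at the random points [A c] and [B c]. *)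
Lemma laplace_smooth d d' (T : measurableType d) (Z : measurableType d')
    (P : probability T K) (m m' : probability Z K) (A B : T -> K) (X : Z -> K) c :
  measurable_fun setT A -> measurable_fun setT B -> measurable_fun setT X ->
  (forall w z, complex.Re c * (A w * X z) <= 0) ->
  (forall w z, complex.Re c * (B w * X z) <= 0) ->
  cintegral P setT (fun w => laplace m X (c * (A w)%:C) *
                             laplace m' X (c * (B w)%:C)) =
  cintegral (triple_law P m m') setT
    (fun q => cexp (c * (A q.1 * X q.2.1 + B q.1 * X q.2.2)%:C)).
Proof.
move=> mA mB mX cA cB.
have mAX (D : T -> K) : measurable_fun setT D ->
    measurable_fun setT (fun q : T * Z => D q.1 * X q.2).
  by move=> mD; apply: measurable_funM; apply: measurableT_comp.
have bA := cbdm_cexp (mAX A mA) (fun q => cA q.1 q.2).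
have bB := cbdm_cexp (mAX B mB) (fun q => cB q.1 q.2).
have := cintegral_prod_mul P m m' bA bB => /=.
rewrite [X in _ = X -> _](_ : _ = cintegral (triple_law P m m') setT
    (fun q => cexp (c * (A q.1 * X q.2.1 + B q.1 * X q.2.2)%:C))); last first.
  by apply: eq_cintegral => q; rewrite -cexpD -mulrDr -rmorphD.
move=> <-; apply: eq_cintegral => w; rewrite /laplace.
by congr (_ * _); apply: eq_cintegral => z; rewrite -mulrA -rmorphM.
Qed.

End complex_exponential.

(** * The steady state is a fixed point of the smoothing transformation *)

Section steady_state_fixed_point.
Context (K : realType).
Local Open Scope complex_scope.

Section nonnegative_laws.
Variable nu : law K.
Hypothesis nu_ge0 : nu `[(0 : K), +oo[%classic = 1%E.

Let pos (v : K) : K := Num.max v 0.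

Lemma Rintegral_half_line (g : K -> K) : bounded_mfun (g : measurableTypeR K -> K) ->
  \int[nu]_(v in `[(0 : K), +oo[%classic) g v = \int[nu]_v g v.
Proof.
move=> bg; rewrite /Rintegral; congr fine.
have mD : measurable (`[(0 : K), +oo[%classic : set (measurableTypeR K)).
  exact: measurable_itv.
rewrite [RHS](@negligible_integral _ _ _ nu setT (~` `[(0 : K), +oo[%classic))//.
- by rewrite setTD setCK.
- exact: measurableC.
- exact: (bdm_integrable nu bg).
- by have := probability_setC nu mD; rewrite nu_ge0 subee.
Qed.

Lemma Rintegral_pos (g : K -> K) : bounded_mfun (g : measurableTypeR K -> K) ->
  \int[nu]_v g (pos v) = \int[nu]_v g v.
Proof.
move=> bg; have mp : measurable_fun setT (pos : measurableTypeR K -> measurableTypeR K).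
  exact: measurable_maxr.
rewrite -Rintegral_half_line; last exact: bdm_comp mp bg.
rewrite -[RHS]Rintegral_half_line//; apply: eq_Rintegral => v.
by rewrite mem_setE in_itv/= andbT => v0; rewrite /pos (max_idPl v0).
Qed.
End nonnegative_laws.

Lemma stable_scale_ge0 (alpha c0p c0m : K) : 0 < alpha -> alpha < 1 ->
  0 <= c0p -> 0 <= c0m -> 0 <= stable_scale alpha c0p c0m.
Proof.
move=> a0 a1 cp cm; rewrite /stable_scale divr_ge0//.
  by rewrite mulr_ge0 ?pi_ge0// addr_ge0.
rewrite !mulr_ge0// /Gamma.
  by apply: Rintegral_ge0 => x _; rewrite mulr_ge0 ?powR_ge0 ?expR_ge0.
apply: sin_ge0_pi; apply/andP; split.
  by rewrite divr_ge0// mulr_ge0 ?pi_ge0// ltW.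
rewrite ler_pdivrMr// ler_wpM2l ?pi_ge0//.
by rewrite (le_trans (ltW a1))// ler1n.
Qed.

Variables (d : measure_display) (T : measurableType d) (P : probability T K).
Variables (L R : {RV P >-> K}) (alpha c0p c0m : K) (nu muoo : law K).
Hypotheses (alpha_gt0 : 0 < alpha) (alpha_lt1 : alpha < 1).
Hypotheses (c0p_ge0 : 0 <= c0p) (c0m_ge0 : 0 <= c0m).
Hypotheses (L_ge0 : forall w, 0 <= L w) (R_ge0 : forall w, 0 <= R w).
Hypothesis nu_mixing : mixing_measure L R alpha nu.
Hypothesis muoo_steady : steady_state alpha c0p c0m nu muoo.

(** [nu] does not charge the negative numbers, so passing to positive parts
    does not change integrals; it makes the exponentials with rate of
    nonpositive real part bounded everywhere. *)
Let pos (v : measurableTypeR K) : K := Num.max v 0.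

Let measurable_pos : measurable_fun setT pos.
Proof. exact: measurable_maxr. Qed.

Let pos_ge0 v : 0 <= pos v. Proof. by rewrite /pos le_max lexx orbT. Qed.

Let nu_ge0 : nu `[(0 : K), +oo[%classic = 1%E.
Proof. by have [] := nu_mixing. Qed.

Let stable_exponent xi : K[i] :=
  - (stable_scale alpha c0p c0m * `|xi| `^ alpha)%:C *
    (1 - 'i%C * (stable_skew c0p c0m * tan (pi * alpha / 2) * Num.sg xi)%:C).

Let Re_stable_exponent xi : complex.Re (stable_exponent xi) <= 0.
Proof.
rewrite /stable_exponent /= !(mul0r, mulr0, oppr0, subr0, mulr1).
by rewrite oppr_le0 mulr_ge0 ?powR_ge0// stable_scale_ge0.
Qed.

Let charf_nuE xi : charf nu xi = laplace nu pos ('i%C * xi%:C).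
Proof.
rewrite charf_laplace /laplace /cintegral.
have [b1 b2] : cbounded_mfun (fun z : measurableTypeR K => cexp ('i%C * xi%:C * z%:C)).
  by apply: (@cbdm_cexp K _ (measurableTypeR K)) => // z; rewrite Re_i_real mul0r.
by rewrite -(Rintegral_pos nu_ge0 b1) -(Rintegral_pos nu_ge0 b2).
Qed.

Let charf_muooE xi : charf muoo xi = laplace nu pos (stable_exponent xi).
Proof.
have bp : cbounded_mfun (fun z : measurableTypeR K => cexp (stable_exponent xi * (pos z)%:C)).
  by apply: cbdm_cexp => // z; rewrite mulr_le0_ge0.
rewrite muoo_steady /laplace /cintegral.
rewrite -(Rintegral_half_line nu_ge0 bp.1) -(Rintegral_half_line nu_ge0 bp.2).
have E v : v \in `[(0 : K), +oo[%classic ->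
    - (stable_scale alpha c0p c0m * v * `|xi| `^ alpha)%:C *
    (1 - 'i%C * (stable_skew c0p c0m * tan (pi * alpha / 2) * Num.sg xi)%:C) =
    stable_exponent xi * (pos v)%:C.
  rewrite mem_setE in_itv/= andbT => v0; rewrite /pos (max_idPl v0).
  rewrite /stable_exponent !rmorphM; ring.
by congr Complex; apply: eq_Rintegral => v vD; rewrite E.
Qed.

(** Homogeneity of degree [alpha]. For [l = 0] it relies on [0] to the power
    [alpha] being [0]. *)
Let stable_exponentM (l : K) xi : 0 <= l ->
  stable_exponent (l * xi) = stable_exponent xi * (l `^ alpha)%:C.
Proof.
rewrite le_eqVlt => /predU1P[<-|l0].
  by rewrite /stable_exponent mul0r normr0 powR0 ?gt_eqF// !mulr0 oppr0 mul0r.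
rewrite /stable_exponent sgrM (gtr0_sg l0) mul1r normrM powRM// (gtr0_norm l0).
rewrite !rmorphM; ring.
Qed.

Let smoothed (q : T * (measurableTypeR K * measurableTypeR K)) : measurableTypeR K :=
  L q.1 `^ alpha * pos q.2.1 + R q.1 `^ alpha * pos q.2.2.

Let measurable_powL (X : {RV P >-> K}) :
  measurable_fun setT (fun w => X w `^ alpha).
Proof.
apply: (measurableT_comp (f := fun x : K => x `^ alpha)); first exact: measurable_powR.
exact: measurable_funPT.
Qed.

Let measurable_smoothed : measurable_fun setT smoothed.
Proof.
apply: measurable_funD; apply: measurable_funM.
- by apply: (measurableT_comp (measurable_powL L)).
- apply: (measurableT_comp measurable_pos).
  by apply: (measurableT_comp measurable_fst).
- by apply: (measurableT_comp (measurable_powL R)).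
- apply: (measurableT_comp measurable_pos).
  by apply: (measurableT_comp measurable_snd).
Qed.

HB.instance Definition _ := isMeasurableFun.Build _ _ _ _ smoothed measurable_smoothed.

(** The transform equation of [nu] says that [nu] is the law of [smoothed];
    testing this equality of laws against the exponentials with complex rates
    gives the equation for the steady state. *)
Lemma steady_state_fixed xi : charf muoo xi =
  cintegral P setT (fun w => charf muoo (L w * xi) * charf muoo (R w * xi)).
Proof.
pose Q := distribution (triple_law P nu nu) smoothed.
have nuQ : forall A : set (measurableTypeR K), measurable A -> nu A = Q A.
  apply: charf_inj => x; rewrite charf_distribution.
  have [_ _ ->] := nu_mixing.
  rewrite [RHS](_ : _ = cintegral (triple_law P nu nu) setT (fun q => cexp ('i%C * x%:C *
     (L q.1 `^ alpha * pos q.2.1 + R q.1 `^ alpha * pos q.2.2)%:C)))//.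
  have ix : complex.Re ('i%C * x%:C) = 0 by exact: Re_i_real.
  apply: etrans; last first.
    by apply: (@laplace_smooth K _ _ T (measurableTypeR K) P nu nu
        (fun w => L w `^ alpha) (fun w => R w `^ alpha) pos ('i%C * x%:C)) => //
      w z; rewrite ix mul0r.
  apply: eq_cintegral => w; rewrite !charf_nuE -!mulrA -!rmorphM.
  by rewrite ![x * _]mulrC.
rewrite charf_muooE; set c := stable_exponent xi.
have smoothed_ge0 q : 0 <= smoothed q.
  by rewrite addr_ge0// mulr_ge0 ?powR_ge0.
have bp : cbounded_mfun (fun z : measurableTypeR K => cexp (c * (pos z)%:C)).
  by apply: cbdm_cexp => // z; rewrite mulr_le0_ge0 ?Re_stable_exponent.
transitivity (cintegral Q setT (fun z => cexp (c * (pos z)%:C))).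
  by rewrite /laplace /cintegral /Rintegral; congr (fine _ +i* fine _);
    apply: eq_measure_integral => A mA _; exact: nuQ.
rewrite cintegral_distribution//.
transitivity (cintegral (triple_law P nu nu) setT (fun q => cexp (c *
     (L q.1 `^ alpha * pos q.2.1 + R q.1 `^ alpha * pos q.2.2)%:C))).
  by apply: eq_cintegral => q; rewrite {1}/pos (max_idPl (smoothed_ge0 q)).
have cp (l : K) v : 0 <= l -> complex.Re c * (l * pos v) <= 0.
  by move=> l0; rewrite mulr_le0_ge0 ?Re_stable_exponent// mulr_ge0.
apply: etrans.
  by apply/esym; apply: (@laplace_smooth K _ _ T (measurableTypeR K) P nu nu
      (fun w => L w `^ alpha) (fun w => R w `^ alpha) pos c) => //
    w z; apply: cp; exact: powR_ge0.
by apply: eq_cintegral => w; rewrite !charf_muooE !stable_exponentM.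
Qed.

End steady_state_fixed_point.

Section tail_constants.
Context (K : realType) (mu0 : law K) (alpha : K).

Let distr_fun_itv01 x : 0 <= distr_fun mu0 x <= 1.
Proof.
rewrite /distr_fun fine_ge0//= -[leRHS]/(fine 1%E).
rewrite fine_le ?fin_num_measure// ?probability_le1//.
Qed.

Lemma upper_tail_constant_ge0 c :
  x `^ alpha * (1 - distr_fun mu0 x) @[x --> +oo] --> c -> 0 <= c.
Proof.
move=> /cvgr_to_ge; apply; apply: nearW => x.
by rewrite mulr_ge0 ?powR_ge0// subr_ge0; have /andP[] := distr_fun_itv01 x.
Qed.

Lemma lower_tail_constant_ge0 c :
  `|x| `^ alpha * distr_fun mu0 x @[x --> -oo] --> c -> 0 <= c.
Proof.
move=> /cvgr_to_ge; apply; apply: nearW => x.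
by rewrite mulr_ge0 ?powR_ge0//; have /andP[] := distr_fun_itv01 x.
Qed.

End tail_constants.

(** * Wild sums of couplings *)

Section wild_sequence.
Context (K : realType) d (T : measurableType d) (P : probability T K).
Variables (L R : {RV P >-> K}).
Local Open Scope complex_scope.

Local Notation plane := (measurableTypeR K * measurableTypeR K)%type.

Definition collide (q : T * (plane * plane)) : plane :=
  (L q.1 * q.2.1.1 + R q.1 * q.2.2.1, L q.1 * q.2.1.2 + R q.1 * q.2.2.2).

Lemma measurable_mix (X : plane -> K) : measurable_fun setT X ->
  measurable_fun setT (fun q : T * (plane * plane) =>
    L q.1 * X q.2.1 + R q.1 * X q.2.2).
Proof.
move=> mX; apply: measurable_funD; apply: measurable_funM.
- exact: (measurableT_comp (measurable_funPT L) measurable_fst).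
- apply: (measurableT_comp mX).
  by apply: (measurableT_comp measurable_fst).
- exact: (measurableT_comp (measurable_funPT R) measurable_fst).
- apply: (measurableT_comp mX).
  by apply: (measurableT_comp measurable_snd).
Qed.

Lemma measurable_collide : measurable_fun setT collide.
Proof.
apply: measurable_fun_pair.
  exact: (measurable_mix (X := fst) measurable_fst).
exact: (measurable_mix (X := snd) measurable_snd).
Qed.

HB.instance Definition _ := isMeasurableFun.Build _ _ _ _ collide measurable_collide.

(** Wild's recursion, lifted from laws on the line to laws on the plane: both
    coordinates undergo the same collision, with the same coefficients. The
    marginals then follow Wild's recursion on the line, and the distance of
    the two coordinates can be followed through the collisions. *)
Definition wild_sequence (rho : nat -> probability plane K) : Prop :=
  forall n (f : plane -> \bar K), measurable_fun setT f ->
    (forall z, 0 <= f z)%E ->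
    (n.+1%:R%:E * \int[rho n.+1]_z f z = \sum_(j < n.+1)
      \int[triple_law P (rho j) (rho (n - j)%N)]_q f (collide q))%E.

Lemma wild_sequence_exists (m0 : probability plane K) :
  exists rho, rho 0%N = m0 /\ wild_sequence rho.
Proof.
apply: (@history_exists _ m0 (fun n h x => forall f : plane -> \bar K,
    measurable_fun setT f -> (forall z, 0 <= f z)%E ->
    (n.+1%:R%:E * \int[x]_z f z = \sum_(j < n.+1)
      \int[triple_law P (h j) (h (n - j)%N)]_q f (collide q))%E)).
- move=> n h.
  have [Q HQ] := average_exists n
    (fun j => distribution (triple_law P (h j) (h (n - j)%N)) collide).
  exists Q => f mf f0; rewrite HQ//; apply: eq_bigr => j _.
  by rewrite ge0_integral_distribution.
- move=> n h h' x hh' H f mf f0; apply: (etrans (H f mf f0)).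
  apply: eq_bigr => j _.
  by rewrite (hh' j (ltn_ord j)) (hh' (n - j)%N (leq_subr _ _)).
Qed.

Variable rho : nat -> probability plane K.
Hypothesis rho_wild : wild_sequence rho.

Lemma wild_Rintegral n (f : plane -> K) : bounded_mfun f ->
  n.+1%:R * \int[rho n.+1]_z f z = \sum_(j < n.+1)
    \int[triple_law P (rho j) (rho (n - j)%N)]_q f (collide q).
Proof.
move=> bf; have [M M0] := bdm_ge0_shift bf.
have mf : measurable_fun setT (fun z => (f z + M)%:E).
  by apply/measurable_EFinP; exact: (bdmD bf (bdm_cst _ M)).1.
have := rho_wild n mf M0; rewrite Rintegral_shift//.
have -> : (\sum_(j < n.+1) \int[triple_law P (rho j) (rho (n - j)%N)]_q
    (f (collide q) + M)%:E = \sum_(j < n.+1)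
    (\int[triple_law P (rho j) (rho (n - j)%N)]_q f (collide q) + M)%:E)%E.
  apply: eq_bigr => j _.
  by rewrite (Rintegral_shift _ M (bdm_comp measurable_collide bf)).
rewrite sumEFin -EFinM => -[]; rewrite mulrDr big_split/= sumr_const card_ord.
by rewrite -[M *+ n.+1]mulr_natl => /addIr.
Qed.

Lemma complex_natM n (z : K[i]) :
  n%:R * z = (n%:R * complex.Re z) +i* (n%:R * complex.Im z).
Proof.
rewrite -[n%:R in LHS](rmorph_nat (real_complex K)); case: z => a b.
by apply/eqP; rewrite eq_complex/= !mul0r subr0 addr0 !eqxx.
Qed.

Lemma sum_complex n (u v : 'I_n -> K) :
  \sum_(j < n) (u j +i* v j) = (\sum_(j < n) u j) +i* (\sum_(j < n) v j).
Proof.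
elim: n u v => [|n ih] u v; first by rewrite !big_ord0.
by rewrite !big_ord_recr/= ih.
Qed.

Lemma wild_laplace n (X : plane -> K) xi : measurable_fun setT X ->
  (forall q, X (collide q) = L q.1 * X q.2.1 + R q.1 * X q.2.2) ->
  n.+1%:R * laplace (rho n.+1) X ('i%C * xi%:C) =
  \sum_(j < n.+1) cintegral P setT (fun w =>
    laplace (rho j) X ('i%C * (L w * xi)%:C) *
    laplace (rho (n - j)%N) X ('i%C * (R w * xi)%:C)).
Proof.
move=> mX XE; set c := 'i%C * xi%:C.
have Rec : complex.Re c = 0 by exact: Re_i_real.
have [b1 b2] : cbounded_mfun (fun z => cexp (c * (X z)%:C)).
  by apply: cbdm_cexp => // z; rewrite Rec mul0r.
transitivity (\sum_(j < n.+1) cintegral (triple_law P (rho j) (rho (n - j)%N)) setT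
    (fun q => cexp (c * (L q.1 * X q.2.1 + R q.1 * X q.2.2)%:C))).
  rewrite complex_natM /laplace /cintegral/=.
  rewrite (wild_Rintegral n b1) (wild_Rintegral n b2) -sum_complex.
  by apply: eq_bigr => j _; congr Complex; apply: eq_Rintegral => q _; rewrite XE.
apply: eq_bigr => j _.
apply: etrans.
  by apply/esym; apply: (@laplace_smooth K _ _ T plane P (rho j) (rho (n - j)%N)
      L R X c) => // w z; rewrite Rec mul0r.
apply: eq_cintegral => w; rewrite /c -!mulrA -!rmorphM.
by rewrite ![xi * _]mulrC.
Qed.

(** By induction each of the [n + 1] terms of the recursion is [g] itself. Used
    for the second marginals, which all keep the transform of the steady
    state. *)
Lemma wild_laplace_fixed (X : plane -> K) (g : K -> K[i]) :
  measurable_fun setT X ->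
  (forall q, X (collide q) = L q.1 * X q.2.1 + R q.1 * X q.2.2) ->
  (forall xi, g xi = cintegral P setT (fun w => g (L w * xi) * g (R w * xi))) ->
  (forall xi, laplace (rho 0%N) X ('i%C * xi%:C) = g xi) ->
  forall n xi, laplace (rho n) X ('i%C * xi%:C) = g xi.
Proof.
move=> mX XE gE g0 n.
elim/ltn_ind: n => -[//|n] ih xi.
apply: (@mulfI _ n.+1%:R); first by rewrite pnatr_eq0.
rewrite wild_laplace// (eq_bigr (fun=> g xi)).
  by rewrite sumr_const card_ord mulr_natl.
move=> j _; rewrite [RHS]gE; apply: eq_cintegral => w.
by rewrite !ih// ltnS leq_subr.
Qed.

End wild_sequence.

(** * Moments of the couplings *)

Section power_inequalities.
Context (K : realType).
Implicit Types (u v p q s : K).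

(** For [v <= u], the point [u + v] lies between [u] and [2 u], and the chord
    bounds the convex power function. The point of this form is that each
    mixed term has exponent [1] in one of the variables: after integration it
    carries a first moment, which decays at its own rate. *)
Lemma powR_add_le p u v : 1 < p -> 0 <= u -> 0 <= v ->
  (u + v) `^ p <= u `^ p + v `^ p +
     2 `^ p * (u `^ (p - 1) * v + u * v `^ (p - 1)).
Proof.
move=> p1; have p0 : 0 < p by rewrite (lt_trans ltr01).
wlog vu : u v / v <= u.
  move=> H u0 v0; have [vu|/ltW uv] := leP v u; first exact: H.
  have := H v u uv v0 u0; rewrite addrC => /le_trans; apply.
  rewrite le_eqVlt; apply/orP; left; apply/eqP; ring.
move=> u0 v0.
have key : (u + v) `^ p <= u `^ p + 2 `^ p * (u `^ (p - 1) * v).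
  have [u00|un0] := eqVneq u 0.
    have -> : v = 0 by apply/le_anti; rewrite v0 -u00 vu.
    by rewrite addr0 mulr0 mulr0 addr0.
  have ugt0 : 0 < u by rewrite lt_def un0.
  set t := v / u.
  have t0 : 0 <= t by rewrite divr_ge0.
  have t1 : t <= 1 by rewrite ler_pdivrMr// mul1r.
  have cvx : (t * (2 * u) + (1 - t) * u) `^ p <= t * (2 * u) `^ p + (1 - t) * u `^ p.
    by apply: (convex_powR (ltW p1) (Itv01 t0 t1));
      rewrite ?inE/= in_itv/= andbT ?mulr_ge0.
  have -> : u + v = t * (2 * u) + (1 - t) * u.
    by rewrite /t; field.
  apply: (le_trans cvx); rewrite powRM// addrC lerD//.
    by rewrite ler_piMl ?powR_ge0// gerBl.
  rewrite -(mulr_powRB1 u0 p0) le_eqVlt; apply/orP; left; apply/eqP.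
  by rewrite /t; field.
apply: (le_trans key); rewrite mulrDr addrA -[leLHS]addr0 lerD//.
  by rewrite lerD2r lerDl powR_ge0.
by rewrite !mulr_ge0 ?powR_ge0.
Qed.

(** Whether [u] is below or above [e^(- s)] decides which of the two terms
    suffices; [s] is left free to be optimised after integration. *)
Lemma powR_interpolation p u s : 1 < p -> 0 <= u ->
  u `^ (p - 1) <= expR (- (p - 1) * s) + expR s * u `^ p.
Proof.
move=> p1 u0; have p10 : 0 < p - 1 by rewrite subr_gt0.
have [us|us] := leP (u) (expR (- s)).
  rewrite (@le_trans _ _ (expR (- s) `^ (p - 1)))//.
    by rewrite ge0_ler_powR// ?nnegrE ?expR_ge0// ltW.
  by rewrite -expRM mulrC mulNr mulrN lerDl mulr_ge0 ?expR_ge0 ?powR_ge0.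
have up : u * u `^ (p - 1) = u `^ p by rewrite mulr_powRB1// (lt_trans ltr01).
apply: (@le_trans _ _ (expR s * u `^ p)); last by rewrite lerDr expR_ge0.
rewrite -up mulrA ler_peMl ?powR_ge0// -(@ler_pM2l _ (expR (- s))) ?expR_gt0//.
by rewrite mulr1 mulrA -expRD addNr expR0 mul1r ltW.
Qed.

Lemma powR_le_1D p q u : 0 <= q -> q <= p -> 0 <= u -> u `^ q <= 1 + u `^ p.
Proof.
move=> q0 qp u0; have [u1|/ltW u1] := leP u 1.
  apply: (@le_trans _ _ 1); last by rewrite lerDl powR_ge0.
  have -> : (1 : K) = 1 `^ q by rewrite powR1.
  by rewrite ge0_ler_powR// nnegrE.
by rewrite (le_trans (ler_powR u1 qp))// lerDr.
Qed.

Lemma powR_mixed_le p u v : 1 < p -> 0 <= u -> 0 <= v ->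
  u `^ (p - 1) * v <= u `^ p + v `^ p.
Proof.
move=> p1; have p0 : 0 < p by rewrite (lt_trans ltr01).
move=> u0 v0; have p10 : 0 <= p - 1 by rewrite subr_ge0 ltW.
have [uv|/ltW vu] := leP u v.
  apply: (@le_trans _ _ (v `^ p)); last by rewrite lerDr powR_ge0.
  rewrite -(mulr_powRB1 v0 p0) mulrC ler_wpM2l//.
  by rewrite ge0_ler_powR// nnegrE.
apply: (@le_trans _ _ (u `^ p)); last by rewrite lerDl powR_ge0.
by rewrite -(mulr_powRB1 u0 p0) mulrC ler_wpM2r// powR_ge0.
Qed.

End power_inequalities.

Section triple_tonelli.
Context (K : realType) d d' (T : measurableType d) (Z : measurableType d').
Variables (P : probability T K) (m m' : probability Z K).

Lemma triple_tonelli (f : T -> K) (g h : Z -> K) :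
  measurable_fun setT f -> measurable_fun setT g -> measurable_fun setT h ->
  (forall x, 0 <= f x) -> (forall x, 0 <= g x) -> (forall x, 0 <= h x) ->
  (\int[triple_law P m m']_q (f q.1 * (g q.2.1 * h q.2.2))%:E =
   (\int[P]_w (f w)%:E) * ((\int[m]_z (g z)%:E) * (\int[m']_z (h z)%:E)))%E.
Proof.
move=> mf mg mh f0 g0 h0.
have mgh : measurable_fun setT (fun q : Z * Z => g q.1 * h q.2).
  by apply: measurable_funM; apply: measurableT_comp.
have mfgh : measurable_fun setT (fun q : T * (Z * Z) => f q.1 * (g q.2.1 * h q.2.2)).
  apply: measurable_funM; first exact: measurableT_comp.
  by apply: (measurableT_comp mgh).
have gh0 q : 0 <= g q.1 * h q.2 by rewrite mulr_ge0.
have [mf' mg' mh'] : [/\ measurable_fun setT (EFin \o f),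
  measurable_fun setT (EFin \o g) & measurable_fun setT (EFin \o h)].
  by split; exact/measurable_EFinP.
have mgh' : measurable_fun setT (fun q : Z * Z => (g q.1 * h q.2)%:E).
  exact/measurable_EFinP.
have -> : (\int[m]_z (g z)%:E * \int[m']_z (h z)%:E =
    \int[(m \x m')%E]_q (g q.1 * h q.2)%:E)%E.
  rewrite fubini_tonelli1//.
  rewrite /fubini_F /= -ge0_integralZr//; last 2 first.
  - by move=> z _; rewrite lee_fin.
  - by apply: integral_ge0 => z _; rewrite lee_fin.
  apply: eq_integral => z _; rewrite -ge0_integralZl//; last 2 first.
  - by move=> y _; rewrite lee_fin.
  - by rewrite lee_fin.
have mfgh' : measurable_fun setT (fun q : T * (Z * Z) =>
    (f q.1 * (g q.2.1 * h q.2.2))%:E) by exact/measurable_EFinP.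
rewrite fubini_tonelli1//; last by move=> q; rewrite lee_fin mulr_ge0.
rewrite /fubini_F /= -ge0_integralZr//; last 2 first.
- by move=> w _; rewrite lee_fin.
- by apply: integral_ge0 => q _; rewrite lee_fin.
apply: eq_integral => w _; rewrite -ge0_integralZl//.
- by move=> q _; rewrite lee_fin.
- by rewrite lee_fin.
Qed.

End triple_tonelli.
Section wild_moments.
Context (K : realType) d (T : measurableType d) (P : probability T K).
Variables (L R : {RV P >-> K}).
Hypotheses (L_ge0 : forall w, 0 <= L w) (R_ge0 : forall w, 0 <= R w).

Local Notation plane := (measurableTypeR K * measurableTypeR K)%type.

Local Notation coll := (@collide K d T P L R).

Definition gap (z : plane) : K := `|z.1 - z.2|.

Lemma measurable_gap : measurable_fun setT gap.
Proof.
apply: measurableT_comp; first exact: normr_measurable.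
by apply: measurable_funB; [exact: measurable_fst|exact: measurable_snd].
Qed.

Lemma measurable_fpowR d' (Z : measurableType d') (X : Z -> K) s :
  measurable_fun setT X -> measurable_fun setT (fun z => X z `^ s).
Proof.
by move=> mX; apply: (measurableT_comp (f := fun x : K => x `^ s)) mX;
  exact: measurable_powR.
Qed.

Lemma gap_ge0 z : 0 <= gap z. Proof. exact: normr_ge0. Qed.

Lemma gap_collide (q : T * (plane * plane)) :
  gap (coll q : plane) <= L q.1 * gap q.2.1 + R q.1 * gap q.2.2.
Proof.
rewrite /gap /collide/=.
rewrite [X in `|X|](_ : _ = L q.1 * (q.2.1.1 - q.2.1.2) +
  R q.1 * (q.2.2.1 - q.2.2.2)); last ring.
by rewrite (le_trans (ler_normD _ _))// !normrM (ger0_norm (L_ge0 _))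
  (ger0_norm (R_ge0 _)).
Qed.

Let abs_moment (X : {RV P >-> K}) s : \bar K := (\int[P]_w (X w `^ s)%:E)%E.

Lemma momentLR_split s : momentLR L R s = (abs_moment L s + abs_moment R s)%E.
Proof.
rewrite /momentLR unlock; under eq_integral do rewrite EFinD.
rewrite ge0_integralD//.
- by move=> w _; rewrite lee_fin powR_ge0.
- by apply/measurable_EFinP/measurable_fpowR; exact: measurable_funPT.
- by move=> w _; rewrite lee_fin powR_ge0.
- by apply/measurable_EFinP/measurable_fpowR; exact: measurable_funPT.
Qed.

Section one_collision.
Variables m m' : probability plane K.

Let moment (mm : probability plane K) s : \bar K := (\int[mm]_z (gap z `^ s)%:E)%E.

Let mL s : measurable_fun setT (fun w => L w `^ s).
Proof. exact: (measurable_fpowR _ (measurable_funPT _)). Qed.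

Let mR s : measurable_fun setT (fun w => R w `^ s).
Proof. exact: (measurable_fpowR _ (measurable_funPT _)). Qed.

Let mG s : measurable_fun setT (fun z => gap z `^ s).
Proof. exact: (measurable_fpowR _ measurable_gap). Qed.

Lemma triple_tonelli_l (f : T -> K) (g : plane -> K) :
  measurable_fun setT f -> measurable_fun setT g ->
  (forall x, 0 <= f x) -> (forall x, 0 <= g x) ->
  (\int[triple_law P m m']_q (f q.1 * g q.2.1)%:E =
   (\int[P]_w (f w)%:E) * (\int[m]_z (g z)%:E))%E.
Proof.
move=> mf mg f0 g0.
have := @triple_tonelli _ _ _ _ _ P m m' f g (fun=> 1) mf mg
  (measurable_cst _) f0 g0 (fun=> ler01).
rewrite [X in (_ * (_ * X))%E]integral_cst//.
rewrite [X in (_ * (_ * (_ * X)))%E](probability_setT m') !mule1 => <-.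
by apply: eq_integral => q _; rewrite mulr1.
Qed.

Lemma triple_tonelli_r (f : T -> K) (g : plane -> K) :
  measurable_fun setT f -> measurable_fun setT g ->
  (forall x, 0 <= f x) -> (forall x, 0 <= g x) ->
  (\int[triple_law P m m']_q (f q.1 * g q.2.2)%:E =
   (\int[P]_w (f w)%:E) * (\int[m']_z (g z)%:E))%E.
Proof.
move=> mf mg f0 g0.
have := @triple_tonelli _ _ _ _ _ P m m' f (fun=> 1) g mf (measurable_cst _)
  mg f0 (fun=> ler01) g0.
rewrite [X in (_ * (X * _))%E]integral_cst//.
rewrite [X in (_ * ((_ * X) * _))%E](probability_setT m) !mul1e => <-.
by apply: eq_integral => q _; rewrite mul1r.
Qed.

Let mT (f : T -> K) (g h : plane -> K) : measurable_fun setT f ->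
  measurable_fun setT g -> measurable_fun setT h ->
  measurable_fun setT (fun q : T * (plane * plane) =>
    (f q.1 * (g q.2.1 * h q.2.2))%:E).
Proof.
move=> mf mg mh; apply/measurable_EFinP; apply: measurable_funM.
  exact: (measurableT_comp mf).
apply: measurable_funM.
  by apply: (measurableT_comp mg); exact: (measurableT_comp measurable_fst).
by apply: (measurableT_comp mh); exact: (measurableT_comp measurable_snd).
Qed.

Let mTl (f : T -> K) (g : plane -> K) : measurable_fun setT f ->
  measurable_fun setT g -> measurable_fun setT (fun q : T * (plane * plane) =>
    (f q.1 * g q.2.1)%:E).
Proof.
move=> mf mg; have := mT mf mg (measurable_cst (1 : K)).
by under eq_fun do rewrite mulr1.
Qed.

Let mTr (f : T -> K) (g : plane -> K) : measurable_fun setT f ->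
  measurable_fun setT g -> measurable_fun setT (fun q : T * (plane * plane) =>
    (f q.1 * g q.2.2)%:E).
Proof.
move=> mf mg; have := mT mf (measurable_cst (1 : K)) mg.
by under eq_fun do rewrite mul1r.
Qed.

Let mgc s : measurable_fun setT
  (fun q : T * (plane * plane) => (gap (coll q : plane) `^ s)%:E).
Proof.
apply/measurable_EFinP; apply: measurable_fpowR.
by apply: (measurableT_comp measurable_gap); exact: measurable_collide.
Qed.

Lemma collide_first_moment_le :
  (\int[triple_law P m m']_q (gap (coll q : plane) `^ 1)%:E <=
   abs_moment L 1 * moment m 1 + abs_moment R 1 * moment m' 1)%E.
Proof.
rewrite /moment -triple_tonelli_l//; [|by move=> ?; exact: powR_ge0..].
rewrite -triple_tonelli_r//; [|by move=> ?; exact: powR_ge0..].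
rewrite -ge0_integralD//; [|by move=> q _; rewrite lee_fin mulr_ge0 ?powR_ge0
  |exact: (mTl (mL 1) (mG 1))|by move=> q _; rewrite lee_fin mulr_ge0 ?powR_ge0
  |exact: (mTr (mR 1) (mG 1))].
apply: ge0_le_integral => //.
- by move=> q _; rewrite lee_fin powR_ge0.
- by apply: emeasurable_funD; [exact: (mTl (mL 1) (mG 1))|exact: (mTr (mR 1) (mG 1))].
- move=> q _; rewrite -EFinD lee_fin !powRr1 ?gap_ge0 ?L_ge0 ?R_ge0//.
  exact: gap_collide.
Qed.

(** The mean of [L^(p - 1) R] is at most that of [L^p + R^p], hence at most 1;
    the independence of the two particles makes the mixed terms products of
    moments. *)
Lemma collide_moment_le p : 1 < p -> (momentLR L R p <= 1)%E ->
  (\int[triple_law P m m']_q (gap (coll q : plane) `^ p)%:E <=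
   abs_moment L p * moment m p + abs_moment R p * moment m' p +
   (2 `^ p)%:E * (moment m (p - 1) * moment m' 1 +
                  moment m 1 * moment m' (p - 1)))%E.
Proof.
move=> p1 ep1; have p0 : 0 < p by rewrite (lt_trans ltr01).
have mixed (X Y : {RV P >-> K}) : (forall w, 0 <= X w) -> (forall w, 0 <= Y w) ->
    (abs_moment X p + abs_moment Y p <= 1)%E ->
    (\int[P]_w (2 `^ p * (X w `^ (p - 1) * Y w))%:E <= (2 `^ p)%:E)%E.
  move=> X0 Y0 XY.
  have mX s : measurable_fun setT (fun w => (X w `^ s)%:E).
    by apply/measurable_EFinP/measurable_fpowR; exact: measurable_funPT.
  have mY s : measurable_fun setT (fun w => (Y w `^ s)%:E).
    by apply/measurable_EFinP/measurable_fpowR; exact: measurable_funPT.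
  have mXY : measurable_fun setT (fun w => X w `^ (p - 1) * Y w).
    apply: measurable_funM; last exact: measurable_funPT.
    by apply: measurable_fpowR; exact: measurable_funPT.
  under eq_integral do rewrite EFinM.
  rewrite ge0_integralZl//; try first [exact/measurable_EFinP
    |by move=> w _; rewrite lee_fin mulr_ge0 ?powR_ge0
    |by rewrite lee_fin powR_ge0].
  rewrite -[leRHS]mule1 lee_wpmul2l ?lee_fin ?powR_ge0//.
  apply: le_trans XY; rewrite /abs_moment -ge0_integralD//;
    [|by move=> w _; rewrite lee_fin powR_ge0..].
  apply: ge0_le_integral => //.
  - by move=> w _; rewrite lee_fin mulr_ge0 ?powR_ge0.
  - exact/measurable_EFinP.
  - exact: emeasurable_funD.
  - by move=> w _; rewrite -EFinD lee_fin powR_mixed_le.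
have hLR := mixed L R L_ge0 R_ge0.
have hRL := mixed R L R_ge0 L_ge0.
rewrite addeC -momentLR_split in hRL; rewrite -momentLR_split in hLR.
pose c1 w := 2 `^ p * (L w `^ (p - 1) * R w).
pose c2 w := 2 `^ p * (R w `^ (p - 1) * L w).
have mc (X Y : {RV P >-> K}) :
    measurable_fun setT (fun w => 2 `^ p * (X w `^ (p - 1) * Y w)).
  apply: measurable_funM => //; apply: measurable_funM; last exact: measurable_funPT.
  by apply: measurable_fpowR; exact: measurable_funPT.
have c10 w : 0 <= c1 w by rewrite !mulr_ge0 ?powR_ge0.
have c20 w : 0 <= c2 w by rewrite !mulr_ge0 ?powR_ge0.
pose F1 (q : T * (plane * plane)) := (L q.1 `^ p * gap q.2.1 `^ p)%:E.
pose F2 (q : T * (plane * plane)) := (R q.1 `^ p * gap q.2.2 `^ p)%:E.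
pose F3 (q : T * (plane * plane)) :=
  (c1 q.1 * (gap q.2.1 `^ (p - 1) * gap q.2.2 `^ 1))%:E.
pose F4 (q : T * (plane * plane)) :=
  (c2 q.1 * (gap q.2.1 `^ 1 * gap q.2.2 `^ (p - 1)))%:E.
have mF1 : measurable_fun setT F1 by exact: (mTl (mL p) (mG p)).
have mF2 : measurable_fun setT F2 by exact: (mTr (mR p) (mG p)).
have mF3 : measurable_fun setT F3 by exact: (mT (mc L R) (mG (p - 1)) (mG 1)).
have mF4 : measurable_fun setT F4 by exact: (mT (mc R L) (mG 1) (mG (p - 1))).
have F10 q : (0 <= F1 q)%E by rewrite lee_fin mulr_ge0 ?powR_ge0.
have F20 q : (0 <= F2 q)%E by rewrite lee_fin mulr_ge0 ?powR_ge0.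
have F30 q : (0 <= F3 q)%E by rewrite lee_fin !mulr_ge0 ?powR_ge0.
have F40 q : (0 <= F4 q)%E by rewrite lee_fin !mulr_ge0 ?powR_ge0.
apply: (@le_trans _ _
  (\int[triple_law P m m']_q ((F1 q + F2 q) + (F3 q + F4 q)))%E).
  apply: ge0_le_integral => //.
  - by move=> q _; rewrite lee_fin powR_ge0.
  - by apply: emeasurable_funD; exact: emeasurable_funD.
  - move=> q _; rewrite -!EFinD lee_fin.
    apply: (@le_trans _ _ ((L q.1 * gap q.2.1 + R q.1 * gap q.2.2) `^ p)).
      by rewrite ge0_ler_powR ?nnegrE ?gap_ge0 ?(ltW p0) ?gap_collide//
        addr_ge0// mulr_ge0 ?gap_ge0.
    have u0 : 0 <= L q.1 * gap q.2.1 by rewrite mulr_ge0 ?gap_ge0.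
    have v0 : 0 <= R q.1 * gap q.2.2 by rewrite mulr_ge0 ?gap_ge0.
    apply: (le_trans (powR_add_le p1 u0 v0)).
    rewrite !powRM ?gap_ge0// !powRr1 ?gap_ge0// /c1 /c2.
    by rewrite le_eqVlt; apply/orP; left; apply/eqP; ring.
rewrite ge0_integralD//; [|by move=> q _; exact: adde_ge0
  |exact: emeasurable_funD|by move=> q _; exact: adde_ge0|exact: emeasurable_funD].
rewrite ge0_integralD// ge0_integralD//.
have gp s z : 0 <= gap z `^ s by exact: powR_ge0.
have pL w : 0 <= L w `^ p by exact: powR_ge0.
have pR w : 0 <= R w `^ p by exact: powR_ge0.
have M0 (mm : probability plane K) s : (0 <= moment mm s)%E.
  by apply: integral_ge0 => z _; rewrite lee_fin.
have E1 : (\int[triple_law P m m']_q F1 q = abs_moment L p * moment m p)%E.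
  exact: (triple_tonelli_l (mL p) (mG p) pL (gp p)).
have E2 : (\int[triple_law P m m']_q F2 q = abs_moment R p * moment m' p)%E.
  exact: (triple_tonelli_r (mR p) (mG p) pR (gp p)).
have E3 : (\int[triple_law P m m']_q F3 q =
    (\int[P]_w (c1 w)%:E) * (moment m (p - 1) * moment m' 1))%E.
  exact: (triple_tonelli P m m' (mc L R) (mG (p - 1)) (mG 1) c10 (gp (p - 1)) (gp 1)).
have E4 : (\int[triple_law P m m']_q F4 q =
    (\int[P]_w (c2 w)%:E) * (moment m 1 * moment m' (p - 1)))%E.
  exact: (triple_tonelli P m m' (mc R L) (mG 1) (mG (p - 1)) c20 (gp 1) (gp (p - 1))).
rewrite E1 E2 E3 E4 leeD//.
rewrite [leRHS]ge0_muleDr; [|by rewrite mule_ge0 ?M0|by rewrite mule_ge0 ?M0].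
by apply: leeD; rewrite lee_wpmul2r ?mule_ge0 ?M0 ?hLR ?hRL.
Qed.

End one_collision.

End wild_moments.
Section wild_growth.
Context (K : realType) d (T : measurableType d) (P : probability T K).
Variables (L R : {RV P >-> K}) (p : K).
Hypotheses (L_ge0 : forall w, 0 <= L w) (R_ge0 : forall w, 0 <= R w).
Hypotheses (p_gt1 : 1 < p) (ep_lt1 : (momentLR L R p < 1)%E).

Local Notation plane := (measurableTypeR K * measurableTypeR K)%type.

Variable rho : nat -> probability plane K.
Hypothesis rho_wild : wild_sequence L R rho.

Definition gap_moment (m : probability plane K) s : \bar K :=
  (\int[m]_z (gap z `^ s)%:E)%E.

Hypothesis gap0 : (gap_moment (rho 0%N) p < +oo)%E.

Let p0 : 0 < p. Proof. exact: lt_trans p_gt1. Qed.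

Let lm s : \bar K := (\int[P]_w (L w `^ s)%:E)%E.
Let rm s : \bar K := (\int[P]_w (R w `^ s)%:E)%E.

Let lm0 s : (0 <= lm s)%E.
Proof. by apply: integral_ge0 => w _; rewrite lee_fin powR_ge0. Qed.

Let rm0 s : (0 <= rm s)%E.
Proof. by apply: integral_ge0 => w _; rewrite lee_fin powR_ge0. Qed.

Let powR_fin d' (Z : measurableType d') (m : probability Z K) (X : Z -> K) s :
  measurable_fun setT X -> (forall z, 0 <= X z) -> 0 <= s -> s <= p ->
  (\int[m]_z (X z `^ p)%:E < +oo)%E -> (\int[m]_z (X z `^ s)%:E)%E \is a fin_num.
Proof.
move=> mX X0 s0 sp fin.
have mXs q : measurable_fun setT (fun z => (X z `^ q)%:E).
  by apply/measurable_EFinP; exact: measurable_fpowR.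
rewrite ge0_fin_numE; last by apply: integral_ge0 => z _; rewrite lee_fin powR_ge0.
apply: (@le_lt_trans _ _ (\int[m]_z (1 + (X z `^ p)%:E))%E).
  apply: ge0_le_integral => //.
  - by move=> z _; rewrite lee_fin powR_ge0.
  - exact: emeasurable_funD.
  - by move=> z _; rewrite -EFinD lee_fin powR_le_1D.
rewrite ge0_integralD//; last by move=> z _; rewrite lee_fin powR_ge0.
by rewrite integral_cst// [X in (_ * X)%E](probability_setT m) mule1 lte_add_pinfty// ltry.
Qed.

Let lmp_fin : (lm p < +oo)%E.
Proof.
apply: le_lt_trans (lt_trans ep_lt1 (ltry 1)).
by rewrite momentLR_split leeDl// rm0.
Qed.

Let rmp_fin : (rm p < +oo)%E.
Proof.
apply: le_lt_trans (lt_trans ep_lt1 (ltry 1)).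
by rewrite momentLR_split leeDr// lm0.
Qed.

Let lm_fin s : 0 <= s -> s <= p -> lm s \is a fin_num.
Proof. by move=> s0 sp; apply: powR_fin => //; exact: measurable_funPT. Qed.

Let rm_fin s : 0 <= s -> s <= p -> rm s \is a fin_num.
Proof. by move=> s0 sp; apply: powR_fin => //; exact: measurable_funPT. Qed.

Let momentLR_fine s : 0 <= s -> s <= p ->
  fine (momentLR L R s) = fine (lm s) + fine (rm s).
Proof. by move=> s0 sp; rewrite momentLR_split fineD ?lm_fin ?rm_fin. Qed.

Let gm0 m s : (0 <= gap_moment m s)%E.
Proof. by apply: integral_ge0 => z _; rewrite lee_fin powR_ge0. Qed.

Let gm_fin m s : 0 <= s -> s <= p -> (gap_moment m p < +oo)%E ->
  gap_moment m s \is a fin_num.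
Proof.
by move=> s0 sp fin; apply: powR_fin => //; [exact: measurable_gap|exact: gap_ge0].
Qed.

Let wild_gap n s : (n.+1%:R%:E * gap_moment (rho n.+1) s = \sum_(j < n.+1)
  \int[triple_law P (rho j) (rho (n - j)%N)]_q (gap (collide L R q) `^ s)%:E)%E.
Proof.
rewrite /gap_moment rho_wild//; last by move=> z; rewrite lee_fin powR_ge0.
by apply/measurable_EFinP; apply: measurable_fpowR; exact: measurable_gap.
Qed.

Let p1_ge0 : 0 <= p - 1. Proof. by rewrite subr_ge0 ltW. Qed.

Let p1_lep : p - 1 <= p. Proof. by rewrite gerBl. Qed.

(** The recursion bounds a moment by moments of the same order of the previous
    terms and by moments of lower order, which they control. *)
Lemma gap_moment_lty n : (gap_moment (rho n) p < +oo)%E.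
Proof.
elim/ltn_ind: n => -[//|n] ih.
have ih' s m : 0 <= s -> s <= p -> (m <= n)%N -> gap_moment (rho m) s \is a fin_num.
  by move=> s0 sp mn; apply: gm_fin => //; exact: ih.
rewrite ltey; apply/eqP => E; have := wild_gap n p.
rewrite E gt0_muley ?lte_fin ?ltr0n// => S.
suff : (+oo < +oo :> \bar K)%E by rewrite ltxx.
rewrite {1}S; apply/lte_sum_pinfty => j _.
have h := collide_moment_le L_ge0 R_ge0 (rho j) (rho (n - j)%N) p_gt1 (ltW ep_lt1).
apply: (le_lt_trans h).
have jn : (j <= n)%N by rewrite -ltnS.
have njn : (n - j <= n)%N := leq_subr _ _.
have p1 : 1 <= p := ltW p_gt1.
have p00 : 0 <= p := ltW p0.
rewrite -/(lm p) -/(rm p).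
rewrite -/(gap_moment (rho j) p) -/(gap_moment (rho (n - j)%N) p).
rewrite -/(gap_moment (rho j) (p - 1)) -/(gap_moment (rho (n - j)%N) (p - 1)).
rewrite -/(gap_moment (rho j) 1) -/(gap_moment (rho (n - j)%N) 1).
rewrite -(fineK (lm_fin p00 (lexx p))) -(fineK (rm_fin p00 (lexx p))).
rewrite -(fineK (ih' p j p00 (lexx p) jn)) -(fineK (ih' p _ p00 (lexx p) njn)).
rewrite -(fineK (ih' 1 j ler01 p1 jn)) -(fineK (ih' 1 _ ler01 p1 njn)).
rewrite -(fineK (ih' (p - 1) j p1_ge0 p1_lep jn)).
rewrite -(fineK (ih' (p - 1) _ p1_ge0 p1_lep njn)).
by rewrite -!(EFinM, EFinD) ltry.
Qed.

Let a n := fine (gap_moment (rho n) 1).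
Let b n := fine (gap_moment (rho n) p).
Let c n := fine (gap_moment (rho n) (p - 1)).

Let gmE n s : 0 <= s -> s <= p ->
  gap_moment (rho n) s = (fine (gap_moment (rho n) s))%:E.
Proof.
by move=> s0 sp; rewrite fineK//; apply: gm_fin => //; exact: gap_moment_lty.
Qed.

Let sum_rev (u : nat -> K) n : \sum_(j < n.+1) u (n - j)%N = \sum_(j < n.+1) u j.
Proof.
rewrite [RHS](reindex_inj rev_ord_inj)/=; apply: eq_bigr => j _.
by rewrite subSS.
Qed.

Let a_step n : n.+1%:R * a n.+1 <= fine (momentLR L R 1) * \sum_(j < n.+1) a j.
Proof.
have p1 : 1 <= p := ltW p_gt1.
rewrite -lee_fin EFinM -gmE// wild_gap.
apply: (@le_trans _ _
    (\sum_(j < n.+1) (fine (lm 1) * a j + fine (rm 1) * a (n - j)%N)%:E)%E).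
  apply: lee_sum => j _.
  apply: (le_trans (collide_first_moment_le L_ge0 R_ge0 _ _)).
  by rewrite EFinD !EFinM /a -!gmE// !fineK ?lm_fin ?rm_fin.
rewrite sumEFin lee_fin big_split/= -!mulr_sumr sum_rev -mulrDl.
by rewrite momentLR_fine.
Qed.

Let b_step n : n.+1%:R * b n.+1 <= fine (momentLR L R p) * \sum_(j < n.+1) b j +
  (2 `^ p * 2) * \sum_(j < n.+1) c j * a (n - j)%N.
Proof.
have p1 : 1 <= p := ltW p_gt1.
have p00 : 0 <= p := ltW p0.
rewrite -lee_fin EFinM -gmE// wild_gap.
apply: (@le_trans _ _ (\sum_(j < n.+1) (fine (lm p) * b j + fine (rm p) * b (n - j)%N
   + 2 `^ p * (c j * a (n - j)%N + a j * c (n - j)%N))%:E)%E).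
  apply: lee_sum => j _.
  apply: (le_trans (collide_moment_le L_ge0 R_ge0 _ _ p_gt1 (ltW ep_lt1))).
  rewrite -/(lm p) -/(rm p) !(EFinD, EFinM) /a /b /c -!gmE//.
  by rewrite !fineK ?lm_fin ?rm_fin.
rewrite sumEFin lee_fin !big_split/= -!mulr_sumr sum_rev -mulrDl -momentLR_fine//.
rewrite lerD2l big_split/= -mulrA ler_wpM2l ?powR_ge0//.
rewrite mulr_natl mulr2n lerD2l le_eqVlt; apply/orP; left; apply/eqP.
rewrite -[RHS](@sum_rev (fun j => c j * a (n - j)%N)).
by apply: eq_bigr => j _; rewrite mulrC subKn// -ltnS.
Qed.

Let c_bound n (s : K) : c n <= expR (- (p - 1) * s) + expR s * b n.
Proof.
have p00 : 0 <= p := ltW p0.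
have mg q : measurable_fun setT (fun z : plane => (gap z `^ q)%:E).
  by apply/measurable_EFinP; apply: measurable_fpowR; exact: measurable_gap.
rewrite -lee_fin EFinD EFinM /b /c -!gmE//.
have -> : ((expR (- (p - 1) * s))%:E + (expR s)%:E * gap_moment (rho n) p =
    \int[rho n]_z ((expR (- (p - 1) * s))%:E + (expR s)%:E * (gap z `^ p)%:E))%E.
  rewrite ge0_integralD//.
  - rewrite integral_cst// [X in (_ * X + _)%E](probability_setT (rho n)) mule1.
    by rewrite ge0_integralZl// => z _; rewrite lee_fin powR_ge0.
  - by move=> z _; rewrite mule_ge0// lee_fin ?expR_ge0 ?powR_ge0.
  - exact: measurable_funeM.
apply: ge0_le_integral => //.
- by move=> z _; rewrite lee_fin powR_ge0.
- by apply: emeasurable_funD => //; exact: measurable_funeM.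
- move=> z _; rewrite -EFinM -EFinD lee_fin.
  by rewrite powR_interpolation ?gap_ge0.
Qed.

Lemma wild_moment_growth : exists2 C, 0 <= C & forall N (t : K), 0 <= t ->
  expR (- t) * wsum N b t <=
  (C * mixed_rate (fine (momentLR L R 1) - 1)
     ((fine (momentLR L R p) - 1) / p) t) `^ p.
Proof.
have m0 s : 0 <= fine (momentLR L R s).
  by rewrite fine_ge0// momentLR_split adde_ge0 ?lm0 ?rm0.
apply: (@wsum_moment_growth K p _ _ (2 `^ p * 2) a b c) => //
  n; by rewrite fine_ge0.
Qed.

End wild_growth.

(** * Identification of the solution with its Wild sum *)

Section complex_modulus.
Context (K : realType).
Local Open Scope complex_scope.
Import Normc.
Implicit Types (z : K[i]).

Lemma normcE2 z : normc z = Num.sqrt (complex.Re z ^+ 2 + complex.Im z ^+ 2).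
Proof. by case: z. Qed.

Lemma normc_ge0 z : 0 <= normc z.
Proof. by rewrite normcE2 sqrtr_ge0. Qed.

Lemma normc_real (x : K) : normc x%:C = `|x|.
Proof. by rewrite normcE2/= expr0n/= addr0 sqrtr_sqr. Qed.

(** The modulus is the supremum of the real linear forms of norm one; these
    commute with integrals and derivatives. *)
Lemma normc_ge_form z (a b : K) : a ^+ 2 + b ^+ 2 = 1 ->
  a * complex.Re z + b * complex.Im z <= normc z.
Proof.
move=> ab; rewrite normcE2; set x := complex.Re z; set y := complex.Im z.
apply: (le_trans (ler_norm _)); rewrite -sqrtr_sqr ler_wsqrtr//.
rewrite -[leRHS]mul1r -ab.
have -> : (a ^+ 2 + b ^+ 2) * (x ^+ 2 + y ^+ 2) =
  (a * x + b * y) ^+ 2 + (a * y - b * x) ^+ 2 by ring.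
by rewrite lerDl sqr_ge0.
Qed.

Lemma normc_le_forms z (M : K) : (forall a b : K, a ^+ 2 + b ^+ 2 = 1 ->
  a * complex.Re z + b * complex.Im z <= M) -> normc z <= M.
Proof.
move=> h; have [z0|nz] := eqVneq (normc z) 0.
  rewrite z0; have := h 1 0; rewrite (eq0_normc z0) expr1n expr0n/= addr0.
  by rewrite mulr0 mul0r addr0 => /(_ erefl).
have z2 : normc z ^+ 2 = complex.Re z ^+ 2 + complex.Im z ^+ 2.
  by rewrite normcE2 sqr_sqrtr// addr_ge0 ?sqr_ge0.
have := h (complex.Re z / normc z) (complex.Im z / normc z).
have -> : (complex.Re z / normc z) ^+ 2 + (complex.Im z / normc z) ^+ 2 = 1.
  by rewrite !expr_div_n -mulrDl -z2 divff// expf_neq0.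
move=> /(_ erefl); congr (_ <= _).
rewrite mulrAC [X in _ + X]mulrAC -mulrDl -!expr2 -z2.
by rewrite expr2 mulfK.
Qed.

Lemma normc_sum n (F : 'I_n -> K[i]) :
  normc (\sum_(j < n) F j) <= \sum_(j < n) normc (F j).
Proof.
elim: n F => [|n ih] F; first by rewrite !big_ord0 normc0.
by rewrite !big_ord_recr/= (le_trans (le_normcD _ _))// lerD2r.
Qed.

Context d (T : measurableType d) (m : probability T K).
Implicit Types (F G : T -> K[i]).

Lemma cbdmD F G : cbounded_mfun F -> cbounded_mfun G -> cbounded_mfun (fun x => F x + G x).
Proof.
move=> [F1 F2] [G1 G2]; split.
  have -> : (fun x => complex.Re (F x + G x)) =
      (fun x => complex.Re (F x) + complex.Re (G x)).
    by apply/funext => x; case: (F x); case: (G x).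
  exact: bdmD.
have -> : (fun x => complex.Im (F x + G x)) =
    (fun x => complex.Im (F x) + complex.Im (G x)).
  by apply/funext => x; case: (F x); case: (G x).
exact: bdmD.
Qed.

Lemma cbdm_cst (z : K[i]) : cbounded_mfun (fun _ : T => z).
Proof. by split; exact: bdm_cst. Qed.

Lemma cbdmM F G : cbounded_mfun F -> cbounded_mfun G -> cbounded_mfun (fun x => F x * G x).
Proof.
move=> [F1 F2] [G1 G2]; split.
  have -> : (fun x => complex.Re (F x * G x)) = (fun x =>
      complex.Re (F x) * complex.Re (G x) +
      -1 * (complex.Im (F x) * complex.Im (G x))).
    by apply/funext => x; case: (F x) => ? ?; case: (G x) => ? ? /=; ring.
  by apply: bdmD; [exact: bdmM|apply: bdmZ; exact: bdmM].
have -> : (fun x => complex.Im (F x * G x)) = (fun x =>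
    complex.Re (F x) * complex.Im (G x) + complex.Im (F x) * complex.Re (G x)).
  by apply/funext => x; case: (F x) => ? ?; case: (G x) => ? ? /=; ring.
by apply: bdmD; exact: bdmM.
Qed.

Lemma cbdm_sum n (F : 'I_n -> T -> K[i]) : (forall j, cbounded_mfun (F j)) ->
  cbounded_mfun (fun x => \sum_(j < n) F j x).
Proof.
elim: n F => [|n ih] F bF.
  by under eq_fun do rewrite big_ord0; exact: cbdm_cst.
under eq_fun do rewrite big_ord_recr/=; apply: cbdmD => //; exact: ih.
Qed.

Lemma cintegralD F G : cbounded_mfun F -> cbounded_mfun G ->
  cintegral m setT (fun x => F x + G x) = cintegral m setT F + cintegral m setT G.
Proof.
move=> [F1 F2] [G1 G2]; rewrite /cintegral.
apply/eqP; rewrite eq_complex/=; apply/andP; split; apply/eqP.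
  rewrite -RintegralD//; [|exact: bdm_integrable..].
  by apply: eq_Rintegral => x _; case: (F x); case: (G x).
rewrite -RintegralD//; [|exact: bdm_integrable..].
by apply: eq_Rintegral => x _; case: (F x); case: (G x).
Qed.

Lemma cintegralZ (k : K) F : cbounded_mfun F ->
  cintegral m setT (fun x => k%:C * F x) = k%:C * cintegral m setT F.
Proof.
move=> [F1 F2]; rewrite /cintegral.
apply/eqP; rewrite eq_complex/= !mul0r subr0 addr0; apply/andP; split; apply/eqP.
  rewrite -RintegralZl//; last exact: bdm_integrable.
  by apply: eq_Rintegral => x _; case: (F x) => ? ? /=; rewrite mul0r subr0.
rewrite -RintegralZl//; last exact: bdm_integrable.
by apply: eq_Rintegral => x _; case: (F x) => ? ? /=; rewrite mul0r addr0.
Qed.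

Lemma cintegral_sum n (F : 'I_n -> T -> K[i]) : (forall j, cbounded_mfun (F j)) ->
  cintegral m setT (fun x => \sum_(j < n) F j x) =
  \sum_(j < n) cintegral m setT (F j).
Proof.
elim: n F => [|n ih] F bF.
  rewrite big_ord0 /cintegral; under eq_Rintegral do rewrite big_ord0/=.
  under [X in _ +i* X]eq_Rintegral do rewrite big_ord0/=.
  by rewrite Rintegral_cst// mul0r.
rewrite big_ord_recr/= -ih// -cintegralD//; last exact: cbdm_sum.
by apply: eq_cintegral => x; rewrite big_ord_recr.
Qed.

Lemma normc_cintegral F (M : K) : cbounded_mfun F -> (forall x, normc (F x) <= M) ->
  normc (cintegral m setT F) <= M.
Proof.
move=> [F1 F2] FM; apply: normc_le_forms => a b ab.
have b1 := bdmZ a F1; have b2 := bdmZ b F2.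
rewrite /cintegral/= -!RintegralZl//; [|exact: bdm_integrable..].
rewrite -RintegralD//; [|exact: bdm_integrable..].
have -> : M = \int[m]_x M.
  by rewrite Rintegral_cst// [X in fine X](probability_setT m)/= mulr1.
apply: le_Rintegral => //; [exact: bdm_integrable (bdmD b1 b2)
  |exact: bdm_integrable (bdm_cst T M)|].
by move=> x _; apply: le_trans (normc_ge_form _ ab) (FM x).
Qed.

End complex_modulus.
Section complex_wild_sums.
Context (K : realType).
Local Open Scope complex_scope.
Import Normc.

Lemma normr_Re_le (z : K[i]) : `|complex.Re z| <= normc z.
Proof. by rewrite -sqrtr_sqr normcE2 ler_wsqrtr// lerDl sqr_ge0. Qed.

Lemma normr_Im_le (z : K[i]) : `|complex.Im z| <= normc z.
Proof. by rewrite -sqrtr_sqr normcE2 ler_wsqrtr// lerDr sqr_ge0. Qed.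

Lemma complex_wsum_Re N (t : K) (u : nat -> K[i]) :
  complex.Re (\sum_(n < N) ((1 - expR (- t)) ^+ n)%:C * u n) =
  wsum N (fun n => complex.Re (u n)) t.
Proof.
rewrite /wsum; elim: N => [|N ih]; first by rewrite !big_ord0.
rewrite !big_ord_recr/= -ih; case: (\sum_(_ < _) _) => a b.
by case: (u N) => x y /=; rewrite mul0r subr0.
Qed.

Lemma complex_wsum_Im N (t : K) (u : nat -> K[i]) :
  complex.Im (\sum_(n < N) ((1 - expR (- t)) ^+ n)%:C * u n) =
  wsum N (fun n => complex.Im (u n)) t.
Proof.
rewrite /wsum; elim: N => [|N ih]; first by rewrite !big_ord0.
rewrite !big_ord_recr/= -ih; case: (\sum_(_ < _) _) => a b.
by case: (u N) => x y /=; rewrite mul0r addr0.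
Qed.

End complex_wild_sums.

Section wild_identification.
Context (K : realType) d (T : measurableType d) (P : probability T K).
Variables (L R : {RV P >-> K}).
Local Open Scope complex_scope.
Import Normc.

Lemma cbdm_laplace_comp d' (Z : measurableType d') (m : probability Z K)
    (X : Z -> K) (A : T -> K) :
  measurable_fun setT X -> measurable_fun setT A ->
  cbounded_mfun (fun w => laplace m X ('i%C * (A w)%:C)).
Proof.
move=> mX mA.
have [h1 h2] : cbounded_mfun (fun q : T * Z => cexp ('i%C * (A q.1 * X q.2)%:C)).
  apply: cbdm_cexp; last by move=> q /=; rewrite mul0r.
  by apply: measurable_funM; apply: measurableT_comp.
have E : (fun w => laplace m X ('i%C * (A w)%:C)) =
    (fun w => cintegral m setT (fun z => cexp ('i%C * (A w * X z)%:C))).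
  by apply/funext => w; apply: eq_cintegral => z; rewrite -mulrA -rmorphM.
by rewrite E; split; [exact: (bdm_Rintegral P m h1)|exact: (bdm_Rintegral P m h2)].
Qed.

Lemma normc_cexp_i (x : K) : normc (cexp ('i%C * x%:C)) = 1.
Proof.
by rewrite cexpE normcE2/= !mul0r expR0 !mul1r cos2Dsin2 sqrtr1.
Qed.

Lemma normc_laplace_le1 d' (Z : measurableType d') (m : probability Z K)
    (X : Z -> K) (x : K) : measurable_fun setT X ->
  normc (laplace m X ('i%C * x%:C)) <= 1.
Proof.
move=> mX; have Rx : complex.Re ('i%C * x%:C) = 0 by exact: Re_i_real.
apply: normc_cintegral.
  by apply: cbdm_cexp => // z; rewrite Rx mul0r.
by move=> z; rewrite -mulrA -rmorphM normc_cexp_i.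
Qed.

(** Write the difference as [g1 (g2 - Y_N) + sum_k z^k y_k (g1 - X_(N - k))],
    with [X_n] and [Y_n] the partial sums: each piece is of order [z^N]. With
    [B = e^t], the bound obtained is [e^t] times the derivative of
    [e^t z^(N + 1)], which is why the remainders of all orders can be bounded
    by induction with no loss in the constant. *)
Lemma cauchy_product_remainder (x y : nat -> K[i]) (g1 g2 : K[i]) (z B : K) N :
  0 <= z -> (forall n, normc (y n) <= 1) -> normc g1 <= B ->
  normc (g2 - \sum_(n < N) (z ^+ n)%:C * y n) <= B * z ^+ N ->
  (forall n, (n <= N)%N ->
     normc (g1 - \sum_(k < n) (z ^+ k)%:C * x k) <= B * z ^+ n) ->
  normc (g1 * g2 - \sum_(n < N) (z ^+ n)%:C *
    \sum_(j < n.+1) x (n - j)%N * y j) <= B ^+ 2 * z ^+ N + N%:R * (B * z ^+ N).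
Proof.
move=> z0 y1 g1B g2B g1N.
have B0 : 0 <= B := le_trans (normc_ge0 _) g1B.
have -> : \sum_(n < N) (z ^+ n)%:C * \sum_(j < n.+1) x (n - j)%N * y j =
    \sum_(k < N) (z ^+ k)%:C * y k * \sum_(j < N - k) (z ^+ j)%:C * x j.
  under [RHS]eq_bigr do rewrite mulr_sumr.
  rewrite -(@sum_triangle _
    (fun k j => (z ^+ k)%:C * y k * ((z ^+ j)%:C * x j))).
  apply: eq_bigr => n _; rewrite mulr_sumr; apply: eq_bigr => j _.
  rewrite -[X in z ^+ X](@subnKC j) -1?ltnS// exprD rmorphM/=; ring.
have -> : g1 * g2 - \sum_(k < N) (z ^+ k)%:C * y k *
      \sum_(j < N - k) (z ^+ j)%:C * x j =
    g1 * (g2 - \sum_(k < N) (z ^+ k)%:C * y k) +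
    \sum_(k < N) (z ^+ k)%:C * y k * (g1 - \sum_(j < N - k) (z ^+ j)%:C * x j).
  under [X in _ = _ + X]eq_bigr do rewrite mulrBr.
  rewrite big_split/= sumrN mulrBr addrA; congr (_ - _).
  by rewrite -mulr_suml mulrC [g1 * (\sum_(k < N) _)]mulrC subrK.
apply: (le_trans (le_normcD _ _)); apply: lerD.
  by rewrite normcM expr2 -mulrA ler_pM ?normc_ge0.
apply: (le_trans (normc_sum _)).
rewrite mulr_natl -[N in _ *+ N]card_ord -sumr_const; apply: ler_sum => k _.
rewrite !normcM normc_real ger0_norm ?exprn_ge0//.
apply: (@le_trans _ _ (z ^+ k * 1 * (B * z ^+ (N - k)))).
  rewrite ler_pM ?mulr_ge0 ?exprn_ge0 ?normc_ge0 ?g1N ?leq_subr//.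
  by rewrite ler_wpM2l ?exprn_ge0.
by rewrite mulr1 mulrCA -exprD subnKC// ltnW.
Qed.

Variables (mu0 : law K) (mu : K -> law K).
Hypothesis mu_solution : kinetic_solution L R mu0 mu.

Variable r : nat -> K -> K[i].
Hypothesis r_le1 : forall n xi, normc (r n xi) <= 1.
Hypothesis r_cbdm : forall n xi (A : {RV P >-> K}), cbounded_mfun (fun w => r n (A w * xi)).
Hypothesis r0 : forall xi, r 0%N xi = charf mu0 xi.
Hypothesis rS : forall n xi, n.+1%:R * r n.+1 xi =
  \sum_(j < n.+1) cintegral P setT (fun w => r j (L w * xi) * r (n - j)%N (R w * xi)).

Let phi_t t xi := charf (mu t) xi.

Let phi_le1 t xi : normc (phi_t t xi) <= 1.
Proof. by rewrite /phi_t charf_laplace normc_laplace_le1. Qed.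

Let phi_cbdm t xi (A : {RV P >-> K}) : cbounded_mfun (fun w => phi_t t (A w * xi)).
Proof.
have -> : (fun w => phi_t t (A w * xi)) =
    (fun w => laplace (mu t) id ('i%C * (A w * xi)%:C)).
  by apply/funext => w; rewrite /phi_t charf_laplace.
by apply: cbdm_laplace_comp => //; apply: measurable_funM.
Qed.

Let csum N t xi : K[i] := \sum_(n < N) ((1 - expR (- t)) ^+ n)%:C * r n xi.

Let remainder N t xi : K[i] := (expR t)%:C * phi_t t xi - csum N t xi.

Let collision N t xi : K[i] := cintegral P setT (fun w =>
  (expR t)%:C * phi_t t (L w * xi) * ((expR t)%:C * phi_t t (R w * xi)) -
  \sum_(n < N) ((1 - expR (- t)) ^+ n)%:C *
    \sum_(j < n.+1) r (n - j)%N (L w * xi) * r j (R w * xi)).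

(** Since [e^(2t)] is the square of [e^t] and [z' = e^(- t)], the time
    derivative of the remainder is again a product remainder. *)
Let collisionE N t xi :
  (expR (- t))%:C * collision N t xi =
  (expR t)%:C * cintegral P setT (fun w =>
      phi_t t (L w * xi) * phi_t t (R w * xi)) -
  (expR (- t))%:C * \sum_(n < N) ((1 - expR (- t)) ^+ n)%:C *
     (n.+1%:R * r n.+1 xi).
Proof.
have bphi : cbounded_mfun (fun w => phi_t t (L w * xi) * phi_t t (R w * xi)).
  exact: cbdmM.
have brr j k : cbounded_mfun (fun w => r j (L w * xi) * r k (R w * xi)) by exact: cbdmM.
have bc (k : K) : cbounded_mfun (fun _ : T => k%:C) by exact: cbdm_cst.
have -> : collision N t xi = (expR t * expR t)%:C * cintegral P setT (fun w =>
      phi_t t (L w * xi) * phi_t t (R w * xi)) -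
    \sum_(n < N) ((1 - expR (- t)) ^+ n)%:C * (n.+1%:R * r n.+1 xi).
  rewrite -cintegralZ//.
  have -> : \sum_(n < N) ((1 - expR (- t)) ^+ n)%:C * (n.+1%:R * r n.+1 xi) =
     - cintegral P setT (fun w => \sum_(n < N) (- (1 - expR (- t)) ^+ n)%:C *
    \sum_(j < n.+1) r (n - j)%N (L w * xi) * r j (R w * xi)).
    rewrite cintegral_sum; last first.
      by move=> n; apply: cbdmM => //; apply: cbdm_sum.
    rewrite -sumrN; apply: eq_bigr => n _; rewrite cintegralZ; last exact: cbdm_sum.
    rewrite rmorphN/= mulNr opprK; congr (_ * _).
    rewrite rS cintegral_sum//.
    rewrite [RHS](reindex_inj rev_ord_inj)/=; apply: eq_bigr => j _.
    by rewrite subSS subKn// -ltnS.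
  rewrite opprK -cintegralD; last 2 first.
  - exact: cbdmM.
  - by apply: cbdm_sum => n; apply: cbdmM => //; apply: cbdm_sum.
  apply: eq_cintegral => w; congr (_ + _).
    by rewrite rmorphM/=; ring.
  by rewrite -sumrN; apply: eq_bigr => n _; rewrite rmorphN mulNr.
rewrite mulrBr mulrA -rmorphM/= mulrA -expRD addNr expR0 mul1r.
by [].
Qed.

Let collision_le N (t xi : K) : 0 <= t ->
  (forall n x, (n <= N)%N ->
     normc (remainder n t x) <= expR t * (1 - expR (- t)) ^+ n) ->
  normc (collision N t xi) <= expR t ^+ 2 * (1 - expR (- t)) ^+ N +
     N%:R * (expR t * (1 - expR (- t)) ^+ N).
Proof.
move=> t0 H.
have bc (k : K) : cbounded_mfun (fun _ : T => k%:C) by exact: cbdm_cst.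
have brr j k : cbounded_mfun (fun w => r j (L w * xi) * r k (R w * xi)) by exact: cbdmM.
apply: normc_cintegral.
  have -> : (fun w => (expR t)%:C * phi_t t (L w * xi) *
      ((expR t)%:C * phi_t t (R w * xi)) -
      \sum_(n < N) ((1 - expR (- t)) ^+ n)%:C *
      \sum_(j < n.+1) r (n - j)%N (L w * xi) * r j (R w * xi)) =
    (fun w => (expR t)%:C * phi_t t (L w * xi) *
      ((expR t)%:C * phi_t t (R w * xi)) + (-1)%:C *
      \sum_(n < N) ((1 - expR (- t)) ^+ n)%:C *
      \sum_(j < n.+1) r (n - j)%N (L w * xi) * r j (R w * xi)).
    by apply/funext => w; rewrite rmorphN1 mulN1r.
  apply: cbdmD; first by apply: cbdmM; exact: cbdmM.
  apply: cbdmM => //; apply: cbdm_sum => n; apply: cbdmM => //; exact: cbdm_sum.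
move=> w; apply: (@cauchy_product_remainder (fun j => r j (L w * xi))
  (fun j => r j (R w * xi))) => //.
- exact: wsum_base_ge0.
- rewrite normcM normc_real ger0_norm ?expR_ge0// -[leRHS]mulr1.
  by rewrite ler_wpM2l ?expR_ge0.
- exact: H.
- by move=> n nN; exact: H.
Qed.

(** Two solutions are not compared with each other: the solution is compared
    with the partial sums of the Wild series, whose derivative in time is
    explicit. As [z < 1], letting [N] tend to infinity identifies the
    solution. *)
Lemma remainder_le N (t xi : K) : 0 <= t ->
  normc (remainder N t xi) <= expR t * (1 - expR (- t)) ^+ N.
Proof.
elim/ltn_ind: N t xi => -[|N] ih t xi t0.
  rewrite /remainder /csum big_ord0 subr0 normcM normc_real ger0_norm ?expR_ge0//.
  by rewrite expr0 ler_wpM2l ?expR_ge0.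
apply: normc_le_forms => a b ab.
have [phi0 [cRe cIm] dphi] := mu_solution xi.
pose z (s : K) := 1 - expR (- s).
pose f s := a * (expR s * complex.Re (phi_t s xi) +
                 - 1 * wsum N.+1 (fun n => complex.Re (r n xi)) s) +
            b * (expR s * complex.Im (phi_t s xi) +
                 - 1 * wsum N.+1 (fun n => complex.Im (r n xi)) s).
have fE (s : K) : f s = a * complex.Re (remainder N.+1 s xi) +
                  b * complex.Im (remainder N.+1 s xi).
  rewrite /f -complex_wsum_Re -complex_wsum_Im -/(csum N.+1 s xi) /remainder.
  case: (phi_t s xi) => u v; case: (csum N.+1 s xi) => u' v' /=.
  by rewrite !mul0r subr0 addr0 !mulN1r.
pose h s := expR s * z s ^+ N.+1.
rewrite -fE -subr_le0 -[- (_ * _)]mulN1r -/(h t).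
pose A : set K := `[0, +oo[%classic.
have cexp_ : {within A, continuous (@expR K)}.
  by apply: (@is_derive_within K _ expR) => s _; exact: is_derive_expR.
have cw u : {within A, continuous (wsum N.+1 u : K -> K)}.
  exact: (is_derive_within (fun s _ => is_derive_wsum N u s)).
have dh (s : K) : is_derive s 1 h
    (expR s * z s ^+ N.+1 + expR s * (N.+1%:R * expR (- s) * z s ^+ N)).
  exact: is_derive1_mul (is_derive_expR s) (is_derive1_expn N (is_derive1_base s)).
have ch : {within A, continuous h} by exact: (is_derive_within (fun s _ => dh s)).
have cst_ (k : K) : {within A, continuous (fun _ : K => k)}.
  exact: (is_derive_within (fun s _ => is_derive_cst k s 1)).
have cM (u v : K -> K) : {within A, continuous u} -> {within A, continuous v} ->
    {within A, continuous (fun s => u s * v s)}.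
  by move=> cu cv s; apply: (@continuousM K (subspace A) u v s); [exact: cu|exact: cv].
have cD (u v : K -> K) : {within A, continuous u} -> {within A, continuous v} ->
    {within A, continuous (fun s => u s + v s)}.
  by move=> cu cv s; apply: (@continuousD K _ (subspace A) u v s); [exact: cu|exact: cv].
have cf : {within A, continuous (fun s => f s + - 1 * h s)}.
  apply: (cD _ _ _ (cM _ _ _ _)) => //.
  by apply: (cD _ _ (cM _ _ _ _) (cM _ _ _ _)) => //;
    apply: (cD _ _ (cM _ _ _ _) (cM _ _ _ _)).
have D0 : f 0 + - 1 * h 0 <= 0.
  rewrite /h /z oppr0 expR0 subrr expr0n/= !mulr0 addr0 /f expR0 !mul1r !wsum0.
  by rewrite r0 /phi_t phi0 !mulN1r !subrr !mulr0 addr0.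
apply: le_trans D0.
(* the time derivative of the transform, with a dummy value for [s <= 0] *)
have /choice[dph dphE] (s : K) : exists dt : K[i], 0 < s ->
    is_cderive (fun s => phi_t s xi) s dt /\
    dt + phi_t s xi = cintegral P setT (fun w => phi_t s (L w * xi) * phi_t s (R w * xi)).
  have [s0|s0] := ltP 0 s; last by exists 0.
  by have [dt dt1 dt2] := dphi s s0; exists dt.
pose df s := a * ((expR s * complex.Re (phi_t s xi) + expR s * complex.Re (dph s)) +
     - 1 * (expR (- s) * wsum N (fun n => n.+1%:R * complex.Re (r n.+1 xi)) s)) +
   b * ((expR s * complex.Im (phi_t s xi) + expR s * complex.Im (dph s)) +
     - 1 * (expR (- s) * wsum N (fun n => n.+1%:R * complex.Im (r n.+1 xi)) s)).
have dscale (c : K) (u : K -> K) (du s : K) : is_derive s 1 u du ->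
    is_derive s 1 (fun s => c * u s) (c * du).
  move=> hu; apply: (is_derive_eq (is_derive1_mul (is_derive_cst c s 1) hu)).
  by rewrite mul0r add0r.
have dfE (s : K) : 0 < s -> is_derive s 1 f (df s).
  move=> s0; have [[dRe dIm] _] := dphE s s0.
  by apply: is_derive1_add; apply: (dscale _ _ _); apply: is_derive1_add;
    [exact: is_derive1_mul (is_derive_expR s) _|apply: (dscale _ _ _); exact: is_derive_wsum
    |exact: is_derive1_mul (is_derive_expR s) _|apply: (dscale _ _ _); exact: is_derive_wsum].
apply: (@half_line_nincr K (fun s => f s + - 1 * h s) (fun s => df s + - 1 *
   (expR s * z s ^+ N.+1 + expR s * (N.+1%:R * expR (- s) * z s ^+ N)))) => //.
  by move=> s s0; apply: is_derive1_add (dfE s s0) _; exact: (dscale _ _ _ _ (dh s)).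
move=> s s0; rewrite mulN1r subr_le0.
have [_ eqn] := dphE s s0.
have dfC : df s = a * complex.Re ((expR (- s))%:C * collision N s xi) +
                  b * complex.Im ((expR (- s))%:C * collision N s xi).
  rewrite collisionE -eqn.
  have natE n (v : K[i]) : (complex.Re (n%:R * v) = n%:R * complex.Re v) *
      (complex.Im (n%:R * v) = n%:R * complex.Im v) by rewrite complex_natM.
  rewrite /df; set S := \sum_(n < N) _.
  have -> : wsum N (fun n => n.+1%:R * complex.Re (r n.+1 xi)) s = complex.Re S.
    rewrite /S (@complex_wsum_Re _ N s (fun n => n.+1%:R * r n.+1 xi)).
    by congr wsum; apply/funext => n; rewrite natE.
  have -> : wsum N (fun n => n.+1%:R * complex.Im (r n.+1 xi)) s = complex.Im S.
    rewrite /S (@complex_wsum_Im _ N s (fun n => n.+1%:R * r n.+1 xi)).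
    by congr wsum; apply/funext => n; rewrite natE.
  case: (phi_t s xi) => u v; case: (dph s) => u' v'; case: S => x y /=.
  by ring.
rewrite dfC; apply: (le_trans (normc_ge_form _ ab)).
rewrite normcM normc_real ger0_norm ?expR_ge0//.
have hN := @collision_le N s xi (ltW s0) (fun n x (nN : (n <= N)%N) => ih n nN s x (ltW s0)).
apply: (le_trans (ler_wpM2l (expR_ge0 (- s)) hN)); rewrite -/(z s).
rewrite le_eqVlt; apply/orP; left; apply/eqP.
have E : expR (- s) * expR s = 1 by rewrite -expRD addNr expR0.
(* the derivative of the barrier [h] is equal to the bound on the collision term *)
have alg (e e' Z n : K) : e' * e = 1 -> e' * (e ^+ 2 * Z + n * (e * Z)) =
    e * ((1 - e') * Z) + e * ((n + 1) * e' * Z).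
  move=> e1; transitivity ((e' * e) * (e * Z) + n * ((e' * e) * Z)); first ring.
  transitivity (e * Z - (e' * e) * Z + (n + 1) * ((e' * e) * Z)); last ring.
  by rewrite e1; ring.
by rewrite alg// exprS /z -natr1.
Qed.

End wild_identification.

(** * The Wild mixture couples the solution with the steady state *)

Section wild_mixture.
Context (K : realType) d (Z : measurableType d).
Variables (rho : nat -> probability Z K) (t : K).
Hypothesis t_ge0 : 0 <= t.
Local Open Scope complex_scope.
Import Normc.

Let z : K := 1 - expR (- t).

Let weight n : K := expR (- t) * z ^+ n.

Let z_ge0 : 0 <= z. Proof. exact: wsum_base_ge0. Qed.

Let weight_ge0 n : 0 <= weight n.
Proof. by rewrite mulr_ge0 ?expR_ge0 ?exprn_ge0. Qed.

Lemma cvg_wsum_base : (1 - expR (- t)) ^+ n @[n --> \oo] --> (0 : K).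
Proof.
apply: cvg_expr; rewrite ger0_norm ?z_ge0//.
by rewrite gtrBl expR_gt0.
Qed.

Let weight_sum N (u : nat -> K) :
  \sum_(n < N) weight n * u n = expR (- t) * wsum N u t.
Proof. by rewrite /wsum mulr_sumr; apply: eq_bigr => n _; rewrite mulrA. Qed.

Let weight_series : (\sum_(n <oo) (weight n)%:E = 1)%E.
Proof.
apply: cvg_lim => //.
have -> : (fun n => \sum_(0 <= k < n) (weight k)%:E)%E =
    (fun n => (1 - z ^+ n)%:E).
  apply/funext => n; rewrite big_mkord sumEFin; congr EFin.
  rewrite -wsum1E -weight_sum; apply: eq_bigr => k _; exact/esym/mulr1.
apply: cvg_EFin; first exact: nearW.
rewrite -[X in _ --> X]subr0; apply: cvgB; first exact: cvg_cst.
exact: cvg_wsum_base.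
Qed.

Definition wild_mixture_law (Q : probability Z K) : Prop :=
  forall f : Z -> \bar K, measurable_fun setT f -> (forall x, 0 <= f x)%E ->
    (\int[Q]_x f x = \sum_(n <oo) (expR (- t) * (1 - expR (- t)) ^+ n)%:E *
                     \int[rho n]_x f x)%E.

Lemma wild_mixture_exists : exists Q, wild_mixture_law Q.
Proof. exact: mixture_exists weight_ge0 weight_series. Qed.

Variable Q : probability Z K.
Hypothesis QE : wild_mixture_law Q.

Lemma wild_mixture_Rintegral (f : Z -> K) : bounded_mfun f ->
  expR (- t) * wsum N (fun n => \int[rho n]_x f x) t @[N --> \oo] -->
  \int[Q]_x f x.
Proof.
move=> bf; have [M M0] := bdm_ge0_shift bf.
have mf : measurable_fun setT (fun z => (f z + M)%:E).
  by apply/measurable_EFinP; exact: (bdmD bf (bdm_cst _ M)).1.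
have := QE mf M0; rewrite Rintegral_shift// => E.
have cv : (\sum_(0 <= n < N) (weight n)%:E * \int[rho n]_x (f x + M)%:E)%E
    @[N --> \oo] --> (\int[Q]_x f x + M)%:E.
  rewrite E; apply: is_cvg_nneseries => n _ _.
  by rewrite mule_ge0 ?lee_fin// integral_ge0.
have Ef : (fun N => \sum_(0 <= n < N) (weight n)%:E * \int[rho n]_x (f x + M)%:E)%E =
    (fun N => (expR (- t) * wsum N (fun n => \int[rho n]_x f x) t +
               M * (1 - z ^+ N))%:E).
  apply/funext => N; rewrite big_mkord.
  under eq_bigr do rewrite Rintegral_shift// -EFinM.
  rewrite sumEFin; congr EFin; rewrite -wsum1E -!weight_sum mulr_sumr -big_split/=.
  by apply: eq_bigr => n _; rewrite mulr1 mulrDr [M * _]mulrC.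
rewrite Ef in cv; move/fine_cvg: cv => /= cv.
have cM : M * (1 - z ^+ N) @[N --> \oo] --> M.
  rewrite -[X in _ --> X]mulr1 -[X in _ --> M * X]subr0; apply: cvgMr.
  by apply: cvgB; [exact: cvg_cst|exact: cvg_wsum_base].
have -> : (fun N => expR (- t) * wsum N (fun n => \int[rho n]_x f x) t) =
    (fun N => (expR (- t) * wsum N (fun n => \int[rho n]_x f x) t +
               M * (1 - z ^+ N)) - M * (1 - z ^+ N)).
  by apply/funext => N; rewrite addrK.
rewrite -[X in _ --> X](addrK M); exact: cvgB cv cM.
Qed.

(** The partial Wild sums of the transforms converge both to [phi], by the
    assumed bound, and to the transform of the mixture. *)
Lemma wild_mixture_laplace (X : Z -> K) (xi : K) (phi : K[i]) :
  measurable_fun setT X ->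
  (forall N, normc ((expR t)%:C * phi - \sum_(n < N) ((1 - expR (- t)) ^+ n)%:C *
       laplace (rho n) X ('i%C * xi%:C)) <= expR t * (1 - expR (- t)) ^+ N) ->
  laplace Q X ('i%C * xi%:C) = phi.
Proof.
move=> mX H.
have [b1 b2] : cbounded_mfun (fun z => cexp ('i%C * xi%:C * (X z)%:C)).
  by apply: cbdm_cexp => // x; rewrite Re_i_real mul0r.
have ReS N : complex.Re (\sum_(n < N) ((1 - expR (- t)) ^+ n)%:C *
    laplace (rho n) X ('i%C * xi%:C)) =
    wsum N (fun n => complex.Re (laplace (rho n) X ('i%C * xi%:C))) t.
  exact: complex_wsum_Re.
have ImS N : complex.Im (\sum_(n < N) ((1 - expR (- t)) ^+ n)%:C *
    laplace (rho n) X ('i%C * xi%:C)) =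
    wsum N (fun n => complex.Im (laplace (rho n) X ('i%C * xi%:C))) t.
  exact: complex_wsum_Im.
have lim (u : nat -> K) (v : K) :
    (forall N, `|expR t * v - wsum N u t| <= expR t * (1 - expR (- t)) ^+ N) ->
    expR (- t) * wsum N u t @[N --> \oo] --> v.
  move=> h; have E : expR (- t) * expR t = 1 by rewrite -expRD addNr expR0.
  apply/cvgrPdist_le => e e0.
  have /cvgrPdist_le /(_ e e0) := cvg_wsum_base.
  apply: filterS => N; rewrite sub0r normrN ger0_norm ?exprn_ge0// => zN.
  apply: le_trans zN.
  have -> : v - expR (- t) * wsum N u t = expR (- t) * (expR t * v - wsum N u t).
    by rewrite mulrBr mulrA E mul1r.
  rewrite normrM ger0_norm ?expR_ge0//.
  apply: (le_trans (ler_wpM2l (expR_ge0 _) (h N))).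
  by rewrite mulrA E mul1r.
have hRe := lim (fun n => complex.Re (laplace (rho n) X ('i%C * xi%:C))) (complex.Re phi).
have hIm := lim (fun n => complex.Im (laplace (rho n) X ('i%C * xi%:C))) (complex.Im phi).
have Rez (c : K[i]) : complex.Re ((expR t)%:C * c) = expR t * complex.Re c.
  by case: c => x y /=; rewrite mul0r subr0.
have Imz (c : K[i]) : complex.Im ((expR t)%:C * c) = expR t * complex.Im c.
  by case: c => x y /=; rewrite mul0r addr0.
have ReB (c c' : K[i]) : complex.Re (c - c') = complex.Re c - complex.Re c'.
  by case: c; case: c'.
have ImB (c c' : K[i]) : complex.Im (c - c') = complex.Im c - complex.Im c'.
  by case: c; case: c'.
apply/eqP; rewrite eq_complex; apply/andP; split; apply/eqP.
- apply: (cvg_unique _ (wild_mixture_Rintegral b1)) => //.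
  apply: hRe => N; rewrite -ReS -Rez -ReB.
  exact: le_trans (normr_Re_le _) (H N).
- apply: (cvg_unique _ (wild_mixture_Rintegral b2)) => //.
  apply: hIm => N; rewrite -ImS -Imz -ImB.
  exact: le_trans (normr_Im_le _) (H N).
Qed.

Lemma wild_mixture_le (f : Z -> K) (B : K) :
  measurable_fun setT f -> (forall x, 0 <= f x) ->
  (forall n, \int[rho n]_x (f x)%:E < +oo)%E ->
  (forall N, expR (- t) * wsum N (fun n => \int[rho n]_x f x) t <= B) ->
  (\int[Q]_x (f x)%:E <= B%:E)%E.
Proof.
move=> mf f0 ffin fB.
have f0' x : (0 <= (f x)%:E)%E by rewrite lee_fin.
rewrite QE//; last exact/measurable_EFinP.
have w0 n : (0 <= (weight n)%:E * \int[rho n]_x (f x)%:E)%E.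
  by rewrite mule_ge0 ?lee_fin// integral_ge0.
apply: lime_le; first by apply: is_cvg_nneseries => n _ _; exact: w0.
apply: nearW => N; rewrite big_mkord.
rewrite (eq_bigr (fun n : 'I_N => (weight n * \int[rho n]_x f x)%:E)); last first.
  move=> n _; rewrite [RHS]EFinM /Rintegral fineK// ge0_fin_numE ?ffin//.
  exact: integral_ge0.
by rewrite sumEFin lee_fin (weight_sum N (fun n => \int[rho n]_x f x)).
Qed.

End wild_mixture.

(** * Contraction towards the steady state *)

Section first_moment.
Context (K : realType) d (T : measurableType d) (P : probability T K).
Variables (L R : {RV P >-> K}).
Hypotheses (L_ge0 : forall w, 0 <= L w) (R_ge0 : forall w, 0 <= R w).

(** Exponents interpolate: [1] lies between [alpha] and [p], and the power
    function is log-convex in its exponent. *)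
Lemma powR_interpolate1 (alpha p x : K) : 0 < alpha -> alpha < 1 -> 1 < p -> 0 <= x ->
  x `^ 1 <= (p - 1) / (p - alpha) * x `^ alpha +
            (1 - alpha) / (p - alpha) * x `^ p.
Proof.
move=> a0 a1 p1; rewrite le_eqVlt => /predU1P[<-|x0].
  by rewrite !powR0 ?gt_eqF ?(lt_trans ltr01 p1)// !mulr0 addr0.
have pa : 0 < p - alpha by rewrite subr_gt0 (lt_trans a1).
have t0 : 0 <= (p - 1) / (p - alpha) by apply: divr_ge0; lra.
have t1 : (p - 1) / (p - alpha) <= 1 by rewrite ler_pdivrMr// mul1r; lra.
set u := (p - 1) / (p - alpha) in t0 t1 *.
have h : expR (u * (alpha * ln x) + (1 - u) * (p * ln x)) <=
    u * expR (alpha * ln x) + (1 - u) * expR (p * ln x).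
  exact: (@convex_expR K (Itv01 t0 t1) (alpha * ln x) (p * ln x)).
have pE y : x `^ y = expR (y * ln x) by rewrite /powR gt_eqF.
have <- : 1 - u = (1 - alpha) / (p - alpha) by rewrite /u; field; rewrite gt_eqF.
rewrite !pE; apply: le_trans h; rewrite le_eqVlt; apply/orP; left; apply/eqP.
by congr expR; rewrite /u; field; rewrite gt_eqF.
Qed.

Lemma momentLR1_le1 (alpha p : K) : 0 < alpha -> alpha < 1 -> 1 < p ->
  momentLR L R alpha = 1%E -> (momentLR L R p <= 1)%E -> (momentLR L R 1 <= 1)%E.
Proof.
move=> a0 a1 p1 ma mp.
set u := (p - 1) / (p - alpha); set v := (1 - alpha) / (p - alpha).
have pa : 0 < p - alpha by rewrite subr_gt0 (lt_trans a1).
have u0 : 0 <= u by apply: divr_ge0; lra.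
have v0 : 0 <= v by apply: divr_ge0; lra.
have uv : u + v = 1 by rewrite /u /v; field; rewrite gt_eqF.
have mX s : measurable_fun setT (fun w => (L w `^ s + R w `^ s)%:E).
  apply/measurable_EFinP; apply: measurable_funD;
    by apply: measurable_fpowR; exact: measurable_funPT.
have mom s : momentLR L R s = (\int[P]_w (L w `^ s + R w `^ s)%:E)%E.
  by rewrite /momentLR unlock.
have nn s w : (0 <= (L w `^ s + R w `^ s)%:E)%E by rewrite lee_fin addr_ge0 ?powR_ge0.
apply: (@le_trans _ _ (u%:E * momentLR L R alpha + v%:E * momentLR L R p)%E).
  rewrite !mom -!ge0_integralZl// -ge0_integralD//; first last.
  - exact: measurable_funeM.
  - by move=> w _; rewrite mule_ge0.
  - exact: measurable_funeM.
  - by move=> w _; rewrite mule_ge0.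
  apply: ge0_le_integral => //.
  - by apply: emeasurable_funD; exact: measurable_funeM.
  - move=> w _; rewrite -!EFinM -EFinD lee_fin.
    have := lerD (powR_interpolate1 a0 a1 p1 (L_ge0 w))
                 (powR_interpolate1 a0 a1 p1 (R_ge0 w)).
    by rewrite -/u -/v => /le_trans; apply; rewrite le_eqVlt; apply/orP; left;
      apply/eqP; ring.
rewrite ma mule1 -[leRHS]/(1%:E) -uv EFinD leeD2l//.
by rewrite -[leRHS]mule1 lee_wpmul2l.
Qed.

End first_moment.

Section couplings.
Context (K : realType).
Local Open Scope complex_scope.

Local Notation plane := (measurableTypeR K * measurableTypeR K)%type.

Definition coord1 (z : plane) : measurableTypeR K := z.1.
Definition coord2 (z : plane) : measurableTypeR K := z.2.

Lemma measurable_coord1 : measurable_fun setT coord1.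
Proof. exact: measurable_fst. Qed.

Lemma measurable_coord2 : measurable_fun setT coord2.
Proof. exact: measurable_snd. Qed.

HB.instance Definition _ := isMeasurableFun.Build _ _ _ _ coord1 measurable_coord1.
HB.instance Definition _ := isMeasurableFun.Build _ _ _ _ coord2 measurable_coord2.

Lemma eq_charf (mu nu : law K) xi :
  (forall A : set (measurableTypeR K), measurable A -> mu A = nu A) ->
  charf mu xi = charf nu xi.
Proof.
move=> h; rewrite /charf /cintegral /Rintegral; congr (fine _ +i* fine _);
  by apply: eq_measure_integral => A mA _; exact: h.
Qed.

(** Uniqueness of characteristic functions reduces the coupling condition to
    the transforms of the two coordinates. *)
Lemma coupling_laplace (mu1 mu2 : law K) (m : probability plane K) :
  coupling mu1 mu2 m <->
  forall xi : K, laplace m coord1 ('i%C * xi%:C) = charf mu1 xi /\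
                 laplace m coord2 ('i%C * xi%:C) = charf mu2 xi.
Proof.
have pre1 (A : set (measurableTypeR K)) : coord1 @^-1` A = A `*` setT.
  by apply/seteqP; split => -[x y] //= [].
have pre2 (A : set (measurableTypeR K)) : coord2 @^-1` A = setT `*` A.
  by apply/seteqP; split => -[x y] //= [].
split=> [cm xi|h A mA].
- rewrite -!charf_distribution; split; apply: eq_charf => A mA.
    by rewrite -(cm A mA).1 -pre1.
  by rewrite -(cm A mA).2 -pre2.
- split.
    rewrite -pre1 -[LHS]/(distribution m coord1 A).
    by apply: charf_inj => // xi; rewrite charf_distribution (h xi).1.
  rewrite -pre2 -[LHS]/(distribution m coord2 A).
  by apply: charf_inj => // xi; rewrite charf_distribution (h xi).2.
Qed.

Lemma wasserstein_ltyP (p : K) (mu1 mu2 : law K) : 1 < p ->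
  (wasserstein p mu1 mu2 < +oo)%E ->
  exists2 m, coupling mu1 mu2 m & (gap_moment m p < +oo)%E.
Proof.
move=> p1 /ereal_inf_lt[_ [m cm <-] fin]; exists m => //.
apply: lty_poweRy fin.
have p0 : 0 < p := lt_trans ltr01 p1.
by rewrite gt_eqF// lt_min ltr01 invr_gt0.
Qed.

Lemma wasserstein_le (p B : K) (mu1 mu2 : law K) (m : probability plane K) :
  1 < p -> 0 <= B -> coupling mu1 mu2 m -> (gap_moment m p <= (B `^ p)%:E)%E ->
  (wasserstein p mu1 mu2 <= B%:E)%E.
Proof.
move=> p1 B0 cm mB; have p0 : 0 < p := lt_trans ltr01 p1.
have pV : Num.min 1 p^-1 = p^-1.
  by apply/min_idPr; rewrite invf_le1// ltW.
apply: (@le_trans _ _ (poweR (gap_moment m p) p^-1)).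
  by apply: ereal_inf_lbound; exists m => //; rewrite pV.
have -> : B%:E = poweR (B `^ p)%:E p^-1.
  by rewrite poweR_EFin -powRrM mulfV ?gt_eqF// powRr1.
apply: gt0_ler_poweR => //.
- by rewrite invr_ge0 ltW.
- rewrite in_itv/= leey andbT; apply: integral_ge0 => z _.
  by rewrite lee_fin powR_ge0.
- by rewrite in_itv/= leey andbT lee_fin powR_ge0.
Qed.

End couplings.
Section wild_coupling.
Context (K : realType) d (T : measurableType d) (P : probability T K).
Variables (L R : {RV P >-> K}) (p : K) (mu0 muoo : law K) (mu : K -> law K).
Hypotheses (L_ge0 : forall w, 0 <= L w) (R_ge0 : forall w, 0 <= R w).
Hypotheses (p_gt1 : 1 < p) (ep_lt1 : (momentLR L R p < 1)%E).
Hypothesis mu_solution : kinetic_solution L R mu0 mu.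
Hypothesis muoo_fixed : forall xi, charf muoo xi =
  cintegral P setT (fun w => charf muoo (L w * xi) * charf muoo (R w * xi)).
Local Open Scope complex_scope.
Import Normc.

Local Notation plane := (measurableTypeR K * measurableTypeR K)%type.

Variables (m0 : probability plane K).
Hypotheses (m0_coupling : coupling mu0 muoo m0) (m0_gap : (gap_moment m0 p < +oo)%E).

(** The mixture of the Wild couplings with weights [e^(- t) z^n] has the law
    at time [t] as its first marginal and, since every term has it, the steady
    state as its second one; its cost is bounded by the growth estimate for
    the moments. *)
Lemma contraction_along_wild : exists2 C, 0 <= C & forall t : K, 0 <= t ->
  (wasserstein p (mu t) muoo <= (C * mixed_rate (fine (momentLR L R 1) - 1)
     ((fine (momentLR L R p) - 1) / p) t)%:E)%E.
Proof.
have [rho [rho0 rhoW]] := wild_sequence_exists L R m0.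
have gap0 : (gap_moment (rho 0%N) p < +oo)%E by rewrite rho0.
have [C C0 HC] := wild_moment_growth L_ge0 R_ge0 p_gt1 ep_lt1 rhoW gap0.
have gap_fin := gap_moment_lty L_ge0 R_ge0 p_gt1 ep_lt1 rhoW gap0.
have lap0 := (coupling_laplace mu0 muoo m0).1 m0_coupling.
have X1 (q : T * (plane * plane)) : (@coord1 K) (collide L R q) =
    L q.1 * (@coord1 K) q.2.1 + R q.1 * (@coord1 K) q.2.2 by [].
have X2 (q : T * (plane * plane)) : (@coord2 K) (collide L R q) =
    L q.1 * (@coord2 K) q.2.1 + R q.1 * (@coord2 K) q.2.2 by [].
have r2 n (xi : K) : laplace (rho n) (@coord2 K) ('i%C * xi%:C) = charf muoo xi.
  apply: (wild_laplace_fixed rhoW (@measurable_coord2 K) X2 muoo_fixed) => x.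
  by rewrite rho0; have [] := lap0 x.
exists C => // t t0.
have [Q QE] := wild_mixture_exists rho t0.
have rate_ge0 phi1 phip : 0 <= mixed_rate phi1 phip t.
  rewrite /mixed_rate; case: ifP => _; last exact: expR_ge0.
  by rewrite mulr_ge0 ?expR_ge0// le_max ler01.
apply: (@wasserstein_le _ p _ _ _ Q) => //; first exact: mulr_ge0.
- apply/coupling_laplace => xi; split.
  + apply: (wild_mixture_laplace t0 QE (@measurable_coord1 K)) => N.
    pose r n (x : K) := laplace (rho n) (@coord1 K) ('i%C * x%:C).
    have r_le1 n x : normc (r n x) <= 1
      by exact: (normc_laplace_le1 _ _ (@measurable_coord1 K)).
    have r_cbdm n x (A : {RV P >-> K}) : cbounded_mfun (fun w => r n (A w * x)).
      have mA : measurable_fun setT (fun w => A w * x) by exact: measurable_funM.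
      exact: (cbdm_laplace_comp P (rho n) (@measurable_coord1 K) mA).
    have r0 x : r 0%N x = charf mu0 x by rewrite /r rho0; have [] := lap0 x.
    have rS n x : n.+1%:R * r n.+1 x = \sum_(j < n.+1)
        cintegral P setT (fun w => r j (L w * x) * r (n - j)%N (R w * x)).
      exact: (wild_laplace rhoW n x (@measurable_coord1 K) X1).
    exact: (remainder_le mu_solution r_le1 r_cbdm r0 rS N xi t0).
  + apply: (wild_mixture_laplace t0 QE (@measurable_coord2 K)) => N.
    under eq_bigr do rewrite r2.
    rewrite -mulr_suml -rmorph_sum.
    rewrite -mulrBl normcM -rmorphB normc_real.
    have -> : expR t - \sum_(n < N) (1 - expR (- t)) ^+ n =
        expR t * (1 - expR (- t)) ^+ N.
      have := wsum1E N t; rewrite /wsum; under eq_bigr do rewrite mulr1.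
      move=> /(congr1 (fun y => expR t * y)); rewrite mulrA -expRD subrr expR0 mul1r.
      by move=> ->; ring.
    rewrite ger0_norm ?mulr_ge0 ?exprn_ge0 ?expR_ge0 ?wsum_base_ge0//.
    rewrite -[leRHS]mulr1 ler_wpM2l ?mulr_ge0 ?exprn_ge0 ?expR_ge0 ?wsum_base_ge0//.
    by rewrite charf_laplace normc_laplace_le1.
- apply: (wild_mixture_le t0 QE) => //.
  + by apply: measurable_fpowR; exact: measurable_gap.
  + by move=> z; exact: powR_ge0.
  + by move=> N; exact: HC.
Qed.

End wild_coupling.

Theorem theorem3p3 (K : realType) (d : measure_display) (T : measurableType d)
    (P : probability T K) (L R : {RV P >-> K}) (alpha p : K)
    (mu0 : law K) (c0p c0m : K)
    (mu : K -> law K) (nu muoo : law K) :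
  0 < alpha -> alpha < 1 -> 1 < p ->
  (forall w, 0 <= L w) -> (forall w, 0 <= R w) ->
  (1 < P [set w | (0 < L w)%R] + P [set w | (0 < R w)%R])%E ->
  momentLR L R alpha = 1%E ->
  (momentLR L R p < 1)%E ->
  x `^ alpha * (1 - distr_fun mu0 x) @[x --> +oo] --> c0p ->
  `|x| `^ alpha * distr_fun mu0 x @[x --> -oo] --> c0m ->
  kinetic_solution L R mu0 mu ->
  mixing_measure L R alpha nu ->
  steady_state alpha c0p c0m nu muoo ->
  (wasserstein p mu0 muoo < +oo)%E ->
  exists C : K, forall t : K, 0 <= t ->
    (wasserstein p (mu t) muoo <= (C * rate L R p t)%:E)%E.
Proof.
move=> alpha0 alpha1 p1 L0 R0 _ m_alpha m_p tailp tailm sol mix steady fin.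
have cp := upper_tail_constant_ge0 tailp.
have cm := lower_tail_constant_ge0 tailm.
have fixed := steady_state_fixed alpha0 alpha1 cp cm L0 R0 mix steady.
have [m0 m0c m0g] := wasserstein_ltyP p1 fin.
have [C C0 HC] := contraction_along_wild L0 R0 p1 m_p sol fixed m0c m0g.
exists C => t t0; apply: le_trans (HC t t0) _.
have p0 : 0 < p := lt_trans ltr01 p1.
have fine_le1 s : (momentLR L R s <= 1)%E -> fine (momentLR L R s) <= 1.
  move=> h; have h0 : (0 <= momentLR L R s)%E.
    rewrite momentLR_split adde_ge0// integral_ge0// => w _;
      by rewrite lee_fin powR_ge0.
  rewrite -[leRHS]/(fine 1%E) fine_le//.
  by rewrite ge0_fin_numE// (le_lt_trans h)// ltry.
have e1 := fine_le1 1 (momentLR1_le1 L0 R0 alpha0 alpha1 p1 m_alpha (ltW m_p)).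
have ep := fine_le1 p (ltW m_p).
have phi1E : phi L R 1 = fine (momentLR L R 1) - 1 by rewrite /phi divr1.
have phipE : phi L R p = (fine (momentLR L R p) - 1) / p by [].
have K1_le0 : K1 L R p <= 0.
  rewrite /K1 ge_max phi1E phipE subr_le0 e1/= ler_pdivrMr// mul0r subr_le0//.
rewrite lee_fin ler_wpM2l// /rate /mixed_rate -phi1E -phipE -/(K1 L R p).
by rewrite (ler0_norm K1_le0) mulrN opprK lexx.
Qed.
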